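(* For every integer $n>1$, $\Phi_{4n+1}=(\tilde\phi_0,\dots,\tilde\phi_{4n+1})^T$ generates an orthogonal multiresolution analysis $\{V_p\}_{p=-\infty}^{\infty}$, where $V_0=V_0(\Phi_{4n+1})$ is the closed linear span in $L^2(\mathbf R)$ of $\{\tilde\phi_i(\cdot-j): i=0,\dots,4n+1,\ j\in\mathbf Z\}$ and $V_p=\{f(2^p\cdot):f\in V_0\}$, $p\in\mathbf Z$.
   Context: A sequence $(V_p)_{p\in\mathbf Z}$ with $V_0$ the closed $L^2(\mathbf R)$-span of the integer translates of compactly supported $L^2$ functions $\phi_0,\dots,\phi_r$ and $V_p=\{f(2^p\cdot):f\in V_0\}$ is a multiresolution analysis (MRA) generated by $\phi_0,\dots,\phi_r$ if (a) $\cdots\subset V_{-1}\subset V_0\subset V_1\subset\cdots$ and (b) $\phi_0,\dots,\phi_r$ and their integer translates form a Riesz basis of $V_0$. It is an orthogonal MRA if in addition $\phi_0,\dots,\phi_r$ and their integer translates form an orthogonal basis of $V_0$. $p_n^{\alpha,\beta}$ is the monic Jacobi polynomial of degree $n$ (orthogonal on $[-1,1]$ for the weight $(1-x)^\alpha(1+x)^\beta$) and $p_n^\lambda=p_n^{\lambda-1/2,\lambda-1/2}$ the monic ultraspherical polynomial. For $j\ge2$, $\phi^0_j(t)=(1-t^2)\,p_{j-2}^{5/2}(t)$. For $N\ge2$, $P^N$ is the orthogonal projection of $L^2[-1,1]$ onto the polynomials of degree at most $N$ vanishing at $\pm1$; $r_0^N=(I-P^N)(1+t)$. On $[-1,1]$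 let $\bar u_M(t)=1-|t|t^{M-1}$ for odd $M\ge1$, $\bar u_M(t)=t-|t|t^{M-1}$ for even $M\ge2$, and $u_{N,N-M}=(I-P^N)\bar u_M$. Fix $n>1$. Let $$\alpha_{n+1,2n}(4n+1)=(-1)^n\frac{(4n-1)\,(4n)!\,(n+1)!\,(3n)!}{3\,(2n)!\,(2n+1)!\,(2n+2)!\,(2n-1)!},$$ $$w_{4n+1,n+1,2n}=\alpha_{n+1,2n}(4n+1)\,u_{4n+1,2(n+1)}+u_{4n+1,4n},$$ $$q_{r_0^{4n+1}}(t)=r_0^{4n+1}(t)+3\,\frac{16^n(2n)!(2n+1)!}{(4n+3)(n-1)(4n)!}\,w_{4n+1,n+1,2n}(t),\qquad q_{l_0^{4n+1}}(t)=q_{r_0^{4n+1}}(-t)$$ for $t\in[-1,1]$. (Here $q_{r_0^{4n+1}}$ is $r_0^{4n+1}$ minus its orthogonal projection onto the span of $w_{4n+1,n+1,2n}$.) Define on $\mathbf R$: - $\tilde\phi_0(t)=q_{r_0^{4n+1}}(2t+1)$ for $-1\le t<0$, $\tilde\phi_0(t)=q_{l_0^{4n+1}}(2t-1)$ for $0\le t<1$, and $0$ elsewhere; - $\tilde\phi_1(t)=w_{4n+1,n+1,2n}(2t-1)$ for $0\le t<1$, and $0$ elsewhere; - for $j=2,\dots,4n+1$: $\tilde\phi_j(t)=\phi^0_j(2t-1)$ for $0\le t<1$, and $0$ elsewhere. *)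

(* Defs.v *)
From mathcomp Require Import all_boot all_order all_algebra.
From mathcomp Require Import all_classical all_reals all_analysis.

Set Implicit Arguments.
Unset Strict Implicit.
Unset Printing Implicit Defensive.

Import Order.TTheory GRing.Theory Num.Theory.
Import numFieldNormedType.Exports.

Local Open Scope classical_set_scope.
Local Open Scope ring_scope.

(* Elements of L^2(R) are handled through representatives R -> R. The subspaces
   [closed_span e] and [mra_space Phi p] below are stable under equality almost
   everywhere, so inclusions and equalities between them are those of the
   corresponding subspaces of L^2(R). *)

Definition L2 {R : realType} (f : R -> R) : Prop :=
  f \in Lfun (@lebesgue_measure R) 2%:E.

Definition L2norm {R : realType} (f : R -> R) : R :=
  fine ('N[@lebesgue_measure R]_2%:E[EFin \o f])%E.

Definition L2dot {R : realType} (D : set R) (f g : R -> R) : R :=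
  \int[@lebesgue_measure R]_(x in D) (f x * g x).

Definition lincomb {R : realType} {I : eqType} (e : I -> R -> R)
    (s : seq I) (c : I -> R) : R -> R :=
  fun t => \sum_(i <- s) c i * e i t.

Definition closed_span {R : realType} {I : eqType} (e : I -> R -> R) :
    set (R -> R) :=
  [set f | L2 f /\ forall eps : R, 0 < eps ->
     exists s c, L2norm (f \- lincomb e s c) < eps].

(* The Riesz inequalities are required for all finitely supported coefficient
   families: [s] lists the (distinct) indices of the support. *)
Definition riesz_basis {R : realType} {I : eqType} (e : I -> R -> R)
    (V : set (R -> R)) : Prop :=
  [/\ forall i, L2 (e i),
      closed_span e = V &
      exists A B : R, [/\ 0 < A, 0 < B &
        forall (s : seq I) (c : I -> R), uniq s ->
          A * (\sum_(i <- s) c i ^+ 2) <= L2norm (lincomb e s c) ^+ 2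
            <= B * (\sum_(i <- s) c i ^+ 2)]].

Definition orthogonal_basis {R : realType} {I : eqType} (e : I -> R -> R)
    (V : set (R -> R)) : Prop :=
  [/\ forall i, L2 (e i),
      forall i, L2norm (e i) != 0,
      forall i j, i != j -> L2dot setT (e i) (e j) = 0 &
      closed_span e = V].

Definition compactly_supported {R : realType} (f : R -> R) : Prop :=
  compact (closure [set t | f t != 0]).

Definition translates {R : realType} {r : nat} (Phi : 'I_r.+1 -> R -> R)
    (k : 'I_r.+1 * int) : R -> R :=
  fun t => Phi k.1 (t - k.2%:~R).

Definition mra_space0 {R : realType} {r : nat} (Phi : 'I_r.+1 -> R -> R) :
    set (R -> R) :=
  closed_span (translates Phi).

Definition mra_space {R : realType} {r : nat} (Phi : 'I_r.+1 -> R -> R)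
    (p : int) : set (R -> R) :=
  [set (fun t : R => f ((2 : R) ^ p * t)) | f in mra_space0 Phi].

Definition generates_mra {R : realType} {r : nat} (Phi : 'I_r.+1 -> R -> R) :
    Prop :=
  [/\ forall i, L2 (Phi i),
      forall i, compactly_supported (Phi i),
      forall p : int, mra_space Phi p `<=` mra_space Phi (p + 1) &
      riesz_basis (translates Phi) (mra_space0 Phi)].

Definition generates_orthogonal_mra {R : realType} {r : nat}
    (Phi : 'I_r.+1 -> R -> R) : Prop :=
  generates_mra Phi /\ orthogonal_basis (translates Phi) (mra_space0 Phi).

Definition is_monic_jacobi {R : realType} (a b : R) (n : nat) (p : {poly R}) :
    Prop :=
  [/\ p \is monic, size p = n.+1 &
      forall q : {poly R}, (size q <= n)%N ->
        \int[@lebesgue_measure R]_(x in `[-1, 1])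
          (p.[x] * q.[x] * ((1 - x) `^ a * (1 + x) `^ b)) = 0].

(* Meaningful for [-1 < a] and [-1 < b]: the polynomial is then unique. *)
Definition jacobi {R : realType} (a b : R) (n : nat) : {poly R} :=
  xget 0 [set p | is_monic_jacobi a b n p].

Definition ultraspherical {R : realType} (l : R) (n : nat) : {poly R} :=
  jacobi (l - 1 / 2) (l - 1 / 2) n.

Definition phi0 {R : realType} (j : nat) (t : R) : R :=
  (1 - t ^+ 2) * (ultraspherical (5 / 2) (j - 2)).[t].

Definition bubble {R : realType} (N : nat) : set {poly R} :=
  [set p : {poly R} | [/\ (size p <= N.+1)%N, p.[1] = 0 & p.[-1] = 0]].

Definition is_bubble_proj {R : realType} (N : nat) (f : R -> R)
    (p : {poly R}) : Prop :=
  bubble N p /\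
  forall q : {poly R}, bubble N q ->
    L2dot `[-1, 1] (fun t => f t - p.[t]) (fun t => q.[t]) = 0.

(* The orthogonal projection of [f], square integrable on [-1, 1], onto
   [bubble N]; only the values of [f] on [-1, 1] matter. *)
Definition bubble_proj {R : realType} (N : nat) (f : R -> R) : {poly R} :=
  xget 0 [set p | is_bubble_proj N f p].

Definition bubble_res {R : realType} (N : nat) (f : R -> R) : R -> R :=
  fun t => f t - (bubble_proj N f).[t].

Definition r0 {R : realType} (N : nat) : R -> R :=
  bubble_res N (fun t => 1 + t).

Definition ubar {R : realType} (M : nat) (t : R) : R :=
  (if odd M then 1 else t) - `|t| * t ^+ (M - 1).

(* [u N k] is $u_{N,k}$, i.e. $u_{N,N-M}$ with [k = N - M]. *)
Definition u {R : realType} (N k : nat) : R -> R := bubble_res N (ubar (N - k)).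

Definition alpha {R : realType} (n : nat) : R :=
  (-1) ^+ n *
  ((4 * n%:R - 1) * (4 * n)`!%:R * (n + 1)`!%:R * (3 * n)`!%:R) /
  (3 * (2 * n)`!%:R * (2 * n + 1)`!%:R * (2 * n + 2)`!%:R * (2 * n - 1)`!%:R).

Definition w {R : realType} (n : nat) (t : R) : R :=
  alpha n * u (4 * n + 1) (2 * (n + 1)) t + u (4 * n + 1) (4 * n) t.

Definition qr {R : realType} (n : nat) (t : R) : R :=
  r0 (4 * n + 1) t +
  3 * ((16 ^+ n * (2 * n)`!%:R * (2 * n + 1)`!%:R) /
       ((4 * n%:R + 3) * (n%:R - 1) * (4 * n)`!%:R)) * w n t.

Definition ql {R : realType} (n : nat) (t : R) : R := qr n (- t).

Definition tphi {R : realType} (n : nat) (i : 'I_(4 * n + 1).+1) (t : R) : R :=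
  match val i with
  | 0 => if -1 <= t < 0 then qr n (2 * t + 1)
         else if 0 <= t < 1 then ql n (2 * t - 1) else 0
  | 1 => if 0 <= t < 1 then w n (2 * t - 1) else 0
  | j => if 0 <= t < 1 then phi0 j (2 * t - 1) else 0
  end.

(* Main.v *)
Require Import Defs.
From mathcomp Require Import all_boot all_order all_algebra.
From mathcomp Require Import all_classical all_reals all_analysis.
From mathcomp Require Import measurable_realfun.
From mathcomp Require Import ring lra zify.

(** Write [N = 4 n + 1].  On one cell, [qr] and [ql] are [1 + t] and [1 - t] up
    to a bubble and a multiple of [w], so the restrictions of [V_0] to a cell are
    the polynomials of degree at most [N] plus the line spanned by [w], glued
    continuously at the integers.  Since [w] is itself piecewise polynomial of
    degree at most [N] with a single knot at the midpoint, [V_0] is refinable.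

    Orthogonality reduces to [<qr, ql> = 0].  Split [r0] into its even and odd
    parts [r0e], [r0o], and let [v_M = A_M r0e - u_M], where [A_M] makes [v_M]
    orthogonal to the constants, hence to all even powers up to [4 n].  The
    moments [s |-> \int v_M |t|^s] then form a rational function of [s] with
    known poles (one per exponent of [v_M]) and known zeros [0, 2, ..., 4 n], which
    gives [<v_M, v_M'> = 2 A_M A_M' / (M + M' + 1)].  With
    [x = alpha A_(2n-1) / A_1], the condition [<r0, l0> <w, w> = <r0, w>^2]
    becomes [(3 x + 4 n - 1)^2 = 0], and the given [alpha] is its double root. *)

Set Implicit Arguments.
Unset Strict Implicit.
Unset Printing Implicit Defensive.

Import Order.TTheory GRing.Theory Num.Theory.
Import numFieldNormedType.Exports.

Local Open Scope classical_set_scope.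
Local Open Scope ring_scope.

(** * Partial fractions with prescribed zeros *)

(** Parity shapes the computation. [w] is even, so [qr] and [ql] share the even part [r0e + qc * w]
    and have the opposite odd parts [r0o] and [- r0o]. Hence <qr, ql> = 0 says that removing from
    [r0e] its component along [w] brings its squared norm from 2 / ((2 n + 1) (4 n + 1)) down to
    that of [r0o], which is 2 / ((2 n + 1) (4 n + 3)). None of the projections is computed. An even
    residual is known only by its value at 1 and its orthogonality to bubbles; the bubbles 1 - t^(2
    j) force all its moments against even powers up to 4 n to agree. Such interpolation data fix a
    rational function of the exponent, from which the inner products are read off without knowing a
    single coefficient. Jacobi polynomials and projections are picked by [xget], so their defining
    properties rest on an existence argument. It is done once, for definite forms on polynomials
    over a field, and applied to <bub p, bub q>, whose weight is that of the ultraspherical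
    polynomials of parameter 5 / 2. *)

Section Muntz.
Variable F : fieldType.

Lemma poly_from_roots (m : nat) (p : {poly F}) (y : 'I_m -> F) :
  (size p <= m.+1)%N -> injective y -> (forall j, p.[y j] = 0) ->
  p = p`_m *: \prod_j ('X - (y j)%:P).
Proof.
move=> sp yI py; set q := \prod_j _.
have sq : size q = m.+1 by rewrite /q size_prod_XsubC /index_enum -enumT size_enum_ord.
have qm : q`_m = 1 by have /monicP := monic_prod_XsubC (index_enum 'I_m) xpredT y;
  rewrite /lead_coef sq.
apply/eqP; rewrite -subr_eq0; apply/eqP.
apply: (@roots_geq_poly_eq0 _ _ [seq y j | j <- enum 'I_m]).
- apply/allP => _ /mapP[j _ ->]; rewrite rootE hornerD hornerN hornerZ py sub0r oppr_eq0.
  by rewrite /q horner_prod (bigD1 j) //= hornerXsubC subrr mul0r mulr0.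
- by rewrite map_inj_uniq // enum_uniq.
- rewrite size_map size_enum_ord; apply/leq_sizeP => i im0.
  move: im0; rewrite leq_eqVlt => /predU1P[<-|im];
    first by rewrite coefB coefZ qm mulr1 subrr.
  by rewrite coefB coefZ (nth_default _ (leq_trans sp im)) (nth_default _ (_ : size q <=
    i)%N) ?sq // mulr0 subrr.
Qed.

(* Numerator and denominator of the rational function
   [s |-> \sum_k a k / (s + x k)]. *)
Definition pf_den (m : nat) (x : 'I_m -> F) : {poly F} := \prod_k ('X + (x k)%:P).
Definition pf_num (m : nat) (x a : 'I_m -> F) : {poly F} :=
  \sum_k a k *: \prod_(l | l != k) ('X + (x l)%:P).

Lemma pf_denE m (x : 'I_m -> F) : pf_den x = \prod_k ('X - (- x k)%:P).
Proof. by apply: eq_bigr => k _; rewrite polyCN opprK. Qed.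

Lemma size_pf_den m (x : 'I_m -> F) : size (pf_den x) = m.+1.
Proof. by rewrite pf_denE size_prod_XsubC /index_enum -enumT size_enum_ord. Qed.

Lemma pf_den_monic m (x : 'I_m -> F) : pf_den x \is monic.
Proof. by rewrite pf_denE monic_prod_XsubC. Qed.

Lemma horner_pf_den m (x : 'I_m -> F) s : (pf_den x).[s] = \prod_k (s + x k).
Proof. by rewrite horner_prod; apply: eq_bigr => k _; rewrite hornerD hornerX hornerC. Qed.

Lemma horner_pf_num m (x a : 'I_m -> F) s : (forall k, s + x k != 0) ->
  (pf_num x a).[s] = (\prod_k (s + x k)) * \sum_k a k / (s + x k).
Proof.
move=> sx; rewrite /pf_num horner_sum mulr_sumr; apply: eq_bigr => k _.
rewrite hornerZ horner_prod (bigD1 (P := xpredT) k) //=.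
under eq_bigr do rewrite hornerD hornerX hornerC.
by have := sx k => ?; field.
Qed.

Lemma size_prod_neq m (x : 'I_m.+1 -> F) k :
  size (\prod_(l | l != k) ('X + (x l)%:P)) = m.+1 /\
  \prod_(l | l != k) ('X + (x l)%:P) \is monic.
Proof.
have E : \prod_(l | l != k) ('X + (x l)%:P) = \prod_(l | l != k) ('X - (- x l)%:P).
  by apply: eq_bigr => l _; rewrite polyCN opprK.
have M : \prod_(l | l != k) ('X + (x l)%:P) \is monic by rewrite E monic_prod_XsubC.
split => //; have := size_pf_den x.
rewrite /pf_den (bigD1 k) //= -[x k in X in X * _]opprK polyCN size_monicM ?monicXsubC
  ?monic_neq0 //.
by rewrite size_XsubC => -[].
Qed.

Lemma size_pf_num m (x a : 'I_m -> F) : (size (pf_num x a) <= m)%N.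
Proof.
case: m x a => [|m] x a; first by rewrite /pf_num big_ord0 size_poly0.
apply: (leq_trans (size_sum _ _ _)); apply/bigmax_leqP => k _.
by rewrite (leq_trans (size_scale_leq _ _)) // (size_prod_neq x k).1.
Qed.

(** This is the behaviour at infinity: the sum of the a k / (s + x k) is asymptotic to (sum of the a
    k) / s. *)
Lemma lead_pf_num m (x a : 'I_m.+1 -> F) : (pf_num x a)`_m = \sum_k a k.
Proof.
rewrite /pf_num coef_sum; apply: eq_bigr => k _; rewrite coefZ.
have [s /monicP] := size_prod_neq x k.
by rewrite /lead_coef s /= => ->; rewrite mulr1.
Qed.

(* [c * pf_den x - pf_num x a] has degree [m + 1] and the [m + 1] roots [y j];
   compare the coefficients of degree [m]. *)
Lemma sum_coef_pf_const m (x y a : 'I_m.+1 -> F) (c : F) :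
  injective y -> (forall j k, y j + x k != 0) ->
  (forall j, \sum_k a k / (y j + x k) = c) ->
  \sum_k a k = c * (\sum_k x k + \sum_j y j).
Proof.
move=> yI yx H; pose p := c *: pf_den x - pf_num x a.
have pm1 : p`_m.+1 = c.
  rewrite /p coefB coefZ (nth_default _ (size_pf_num x a)) subr0.
  by have /monicP := pf_den_monic x; rewrite /lead_coef size_pf_den /= => ->; rewrite mulr1.
have pE : p = c *: \prod_j ('X - (y j)%:P).
  rewrite -pm1; apply: poly_from_roots => //.
  - rewrite (leq_trans (size_polyD _ _)) // geq_max size_polyN.
    by rewrite (leq_trans (size_scale_leq _ _)) ?size_pf_den //= (leq_trans (size_pf_num
      _ _)).
  - move=> j; rewrite /p hornerD hornerN hornerZ horner_pf_den horner_pf_num // H.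
    by rewrite mulrC subrr.
have subl (z : 'I_m.+1 -> F) : (\prod_j ('X - (z j)%:P))`_m = - \sum_j z j.
  have := @coefPn_prod_XsubC F [seq z j | j <- index_enum 'I_m.+1].
  by rewrite size_map !big_map /index_enum -enumT size_enum_ord; apply.
have := congr1 (fun q : {poly F} => q`_m) pE.
rewrite /p coefB !coefZ pf_denE !subl lead_pf_num sumrN opprK => E.
rewrite -(subKr (c * \sum_k x k) (\sum_k a k)) E; ring.
Qed.

(* The numerator over all [m + 2] nodes has degree at most [m + 1] and the
   [m + 1] roots [y j]; evaluating it at [- z] isolates the residue [b]. *)
Lemma pf_vanishing m (x y a : 'I_m.+1 -> F) (b z : F) :
  injective y -> (forall j k, y j + x k != 0) -> (forall j, y j + z != 0) ->
  (forall j, \sum_k a k / (y j + x k) + b / (y j + z) = 0) ->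
  let kappa := \sum_k a k + b in
  b * \prod_k (x k - z) = kappa * \prod_j (- z - y j) /\
  forall s, (forall k, s + x k != 0) -> s + z != 0 ->
    \sum_k a k / (s + x k) + b / (s + z) =
    kappa * \prod_j (s - y j) / ((s + z) * \prod_k (s + x k)).
Proof.
move=> yI yx yz H kappa; pose p := ('X + z%:P) * pf_num x a + b *: pf_den x.
have hp s : (forall k, s + x k != 0) -> s + z != 0 ->
    p.[s] = ((s + z) * \prod_k (s + x k)) * (\sum_k a k / (s + x k) + b / (s + z)).
  move=> sx sz; rewrite /p hornerD hornerM hornerZ horner_pf_den horner_pf_num //.
  by rewrite hornerD hornerX hornerC; field.
have pm1 : p`_m.+1 = kappa.
  rewrite /p coefD coefZ mulrDl coefD coefXM coefCM lead_pf_num.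
  rewrite (nth_default _ (size_pf_num x a)) mulr0 addr0.
  by have /monicP := pf_den_monic x; rewrite /lead_coef size_pf_den /= => ->; rewrite mulr1.
have pE : p = kappa *: \prod_j ('X - (y j)%:P).
  rewrite -pm1; apply: poly_from_roots => //.
  - rewrite (leq_trans (size_polyD _ _)) // geq_max.
    rewrite (leq_trans (size_scale_leq _ _)) ?size_pf_den // andbT.
    rewrite (leq_trans (size_polyMleq _ _)) //.
    by rewrite size_XaddC add2n /= ltnS size_pf_num.
  - by move=> j; rewrite hp // H mulr0.
split.
  have := congr1 (horner^~ (- z)) pE.
  rewrite /p hornerD hornerM !hornerZ horner_pf_den hornerD hornerX hornerC addNr mul0r
    add0r.
  rewrite horner_prod.
  under eq_bigr do rewrite addrC; move=> ->.
  by congr (_ * _); apply: eq_bigr => j _; rewrite hornerXsubC.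
move=> s sx sz; have pn0 : \prod_k (s + x k) != 0 by apply/prodf_neq0.
have := hp s sx sz; rewrite pE hornerZ horner_prod.
under eq_bigr do rewrite hornerXsubC; move=> ->.
by field; rewrite pn0.
Qed.

End Muntz.

(** * Definite forms on polynomials *)

Section PolyForms.
Variable F : fieldType.

Definition linear_form (l : {poly F} -> F) :=
  forall a p q, l (a *: p + q) = a * l p + l q.

Lemma linear_form0 l : linear_form l -> l 0 = 0.
Proof. by move=> /(_ (-1) 0 0); rewrite scaler0 addr0 mulN1r addNr. Qed.

(** Gram-Schmidt only divides by values [B e e], so anisotropy replaces positivity and the argument
    runs over any field. *)
Definition definite_form (B : {poly F} -> {poly F} -> F) :=
  [/\ forall p, linear_form (B p), forall p q, B p q = B q p &
      forall p, B p p = 0 -> p = 0].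

Lemma size_lt_monic (n : nat) (p q : {poly F}) :
  p \is monic -> size p = n.+1 -> (size q <= n.+1)%N ->
  (size (q - q`_n *: p)%R <= n)%N.
Proof.
move=> /monicP mp sp sq; apply/leq_sizeP => i.
rewrite leq_eqVlt coefB coefZ => /predU1P[<-|im].
  by move: mp; rewrite /lead_coef sp /= => ->; rewrite mulr1 subrr.
by rewrite (nth_default _ (leq_trans sq im)) (nth_default _ (_ : size p <= i)%N) ?sp //
  mulr0 subrr.
Qed.

(** Gram-Schmidt and Riesz representation in one induction: if [r] represents [B 'X^n] in lower
    degree, then [e = 'X^n - r] is orthogonal to lower degrees, and the representative of [l] found
    so far only needs a correction along [e]. *)
Lemma poly_riesz B l n : definite_form B -> linear_form l ->
  exists2 p : {poly F}, (size p <= n)%N &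
    forall q : {poly F}, (size q <= n)%N -> B p q = l q.
Proof.
move=> [Bl Bs Bd]; have B0 p : B p 0 = 0 by exact: linear_form0.
have Bl' p q r a : B (a *: p + q) r = a * B p r + B q r by rewrite !(Bs _ r) Bl.
elim: n l => [|n IH] l ll.
  exists 0; first by rewrite size_poly0.
  by move=> q; rewrite leqn0 size_poly_eq0 => /eqP ->; rewrite B0 linear_form0.
have [r sr rP] := IH _ (Bl 'X^n).
pose e := 'X^n - r.
have se : size e = n.+1.
  by rewrite /e size_polyDl size_polyXn // size_polyN ltnS.
have me : e \is monic.
  apply/monicP; rewrite /lead_coef se /= /e coefB coefXn eqxx.
  by rewrite (nth_default _ sr) subr0.
have eP (q : {poly F}) : (size q <= n)%N -> B e q = 0.
  by move=> sq; rewrite /e addrC -scaleN1r Bl' (rP q sq) mulN1r addNr.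
have [p' sp' p'P] := IH _ ll.
have Bee : B e e != 0.
  by apply/negP => /eqP /Bd e0; move: se; rewrite e0 size_poly0.
exists ((l e / B e e) *: e + p').
  rewrite (leq_trans (size_polyD _ _)) // geq_max (leq_trans (size_scale_leq _ _)) ?se //=.
  exact: leqW.
move=> q sq; set q' := q - q`_n *: e.
have sq' : (size q' <= n)%N by exact: size_lt_monic.
have : q = q`_n *: e + q' by rewrite addrC subrK.
move: {sq} (q`_n) q' sq' => a q' sq' ->.
rewrite Bl !Bl' ll (Bs p' e) (eP p') // (eP q') // p'P //.
by field.
Qed.

Lemma orthogonal_poly_exists B n : definite_form B ->
  exists p : {poly F}, [/\ p \is monic, size p = n.+1 &
    forall q : {poly F}, (size q <= n)%N -> B p q = 0].
Proof.
move=> dB; have [Bl Bs Bd] := dB; have [r sr rP] := poly_riesz n dB (Bl 'X^n).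
exists ('X^n - r); have se : size (('X^n - r) : {poly F}) = n.+1.
  by rewrite size_polyDl size_polyXn // size_polyN ltnS.
split => // [|q sq].
  apply/monicP; rewrite /lead_coef se /= coefB coefXn eqxx.
  by rewrite (nth_default _ sr) subr0.
by rewrite addrC -scaleN1r Bs Bl !(Bs q) (rP q sq) mulN1r addNr.
Qed.

Lemma monic_family_span (n : nat) (p : nat -> {poly F}) (q : {poly F}) :
  (forall j, (j < n)%N -> p j \is monic /\ size (p j) = j.+1) ->
  (size q <= n)%N -> exists c : nat -> F, q = \sum_(j < n) c j *: p j.
Proof.
elim: n q => [|n IH] q Hp sq.
  exists (fun _ => 0); rewrite big_ord0; apply/eqP.
  by rewrite -size_poly_eq0 -leqn0.
have [mp sp] := Hp n (ltnSn n).
have [|c cE] := IH _ _ (size_lt_monic mp sp sq).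
  by move=> j jn; apply: Hp; exact: ltnW.
exists (fun j => if j == n then q`_n else c j); rewrite big_ord_recr /= eqxx.
rewrite -[LHS](subrK (q`_n *: p n)); congr (_ + _).
by rewrite cE; apply: eq_bigr => j _; rewrite ltn_eqF.
Qed.

End PolyForms.

(** * The inner product on [-1, 1] and the bubble projection *)

Section Integrals.
Variable R : realType.
Notation mu := (@lebesgue_measure R).
Implicit Types f g h : R -> R.

Lemma continuous_integrable f (a b : R) : continuous f ->
  mu.-integrable `[a, b] (EFin \o f).
Proof.
move=> cf; apply: continuous_compact_integrable; first exact: segment_compact.
exact: continuous_subspaceT.
Qed.

Definition itg f : R := \int[mu]_(x in `[-1, 1]) f x.

Lemma eq_itg f g : (forall x, -1 <= x <= 1 -> f x = g x) -> itg f = itg g.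
Proof. by move=> fg; apply: eq_Rintegral => x; rewrite inE /= in_itv; exact: fg. Qed.

Lemma itgD f g : continuous f -> continuous g -> itg (fun x => f x + g x) = itg f + itg g.
Proof. by move=> cf cg; apply: RintegralD => //; exact: continuous_integrable. Qed.

Lemma itgZ a f : continuous f -> itg (fun x => a * f x) = a * itg f.
Proof. by move=> cf; apply: RintegralZl => //; exact: continuous_integrable. Qed.

Lemma itgN f : continuous f -> itg (fun x => f (- x)) = itg f.
Proof.
move=> cf; rewrite /itg /Rintegral; congr fine; apply: esym.
have := @integration_by_substitution_oppr _ f (-1) 1; rewrite opprK; apply; first lra.
exact: continuous_subspaceT.
Qed.

Lemma itg_even f : continuous f -> (forall x, f (- x) = f x) ->
  itg f = 2 * \int[mu]_(x in `[0, 1]) f x.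
Proof.
move=> cf fN; rewrite /itg (@itv_bndbnd_setU _ _ _ (BRight 0)); [|by rewrite bnd_simp;
  lra|by rewrite bnd_simp; lra].
have I a b := continuous_integrable a b cf.
rewrite Rintegral_setU //=; last 2 first.
- by rewrite -itv_bndbnd_setU; [exact: I|rewrite bnd_simp; lra|rewrite bnd_simp; lra].
- apply/disj_setPS => x /=; rewrite !in_itv /= => -[/andP[_ ?] /andP[? _]]; lra.
rewrite Rintegral_itv_obnd_cbnd; last first.
  by apply: integrableS (I 0 1) => //; apply: subset_itvr; rewrite bnd_simp.
rewrite mulr_natl mulr2n; congr (_ + _); rewrite /Rintegral; congr fine.
rewrite -{1}oppr0 (@integration_by_substitution_oppr _ f) ?oppr0 //; first 1 last.
- exact: continuous_subspaceT.
by apply: eq_integral => x _ /=; rewrite fN.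
Qed.

Lemma continuous_exprn (k : nat) : continuous (fun x : R => x ^+ k).
Proof. by move=> x; exact: exprn_continuous. Qed.

Lemma int01_exprn (k : nat) : \int[mu]_(x in `[0, 1]) x ^+ k = (k.+1%:R : R)^-1.
Proof.
rewrite /Rintegral (@continuous_FTC2 _ _ (fun x => (k.+1%:R)^-1 * x ^+ k.+1)) //.
- by rewrite /= expr1n expr0n /= mulr0 mulr1 subr0.
- exact/continuous_subspaceT/continuous_exprn.
- have c : continuous (fun x : R => (k.+1%:R)^-1 * x ^+ k.+1).
    by move=> x; apply: cvgM; [exact: cvg_cst|exact: continuous_exprn].
  split.
  + by move=> x _; apply: derivableZ; exact: exprn_derivable.
  + by apply: cvg_at_right_filter; exact: c.
  + by apply: cvg_at_left_filter; exact: c.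
- move=> x _; rewrite derive1E.
  have -> : (fun y : R => k.+1%:R^-1 * y ^+ k.+1) = k.+1%:R^-1 \*: (fun y : R => y ^+
    k.+1) by [].
  rewrite deriveZ; last exact: exprn_derivable.
  rewrite exp_derive scaler1 /GRing.scale /= -mulr_natl mulrA mulVf ?mul1r ?pnatr_eq0 //.
Qed.

Lemma continuous_norm_exprn (k : nat) : continuous (fun x : R => `|x| ^+ k).
Proof.
move=> x; apply: (@continuous_comp _ _ _ (@Num.norm R R) (fun y => y ^+ k)).
  exact: norm_continuous.
exact: continuous_exprn.
Qed.

Lemma itg_norm_exprn (k : nat) : itg (fun x => `|x| ^+ k) = 2 / k.+1%:R.
Proof.
rewrite itg_even; [|exact: continuous_norm_exprn|by move=> x; rewrite normrN].
rewrite -int01_exprn; congr (_ * _); apply: eq_Rintegral => x.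
by rewrite inE /= in_itv /= => /andP[x0 _]; rewrite ger0_norm.
Qed.

Lemma itg_ge0 f : (forall x, -1 <= x <= 1 -> 0 <= f x) -> 0 <= itg f.
Proof. by move=> f0; apply: Rintegral_ge0 => x; rewrite /= in_itv; exact: f0. Qed.

Lemma finite_set_roots (p : {poly R}) : p != 0 -> finite_set [set x | root p x].
Proof.
move=> pn0; suff [r rP] : exists r : seq R, forall x, root p x -> x \in r.
  by apply: (sub_finite_set _ (finite_seq r)) => x /= /rP.
elim: (size p) {-2}p (leqnn (size p)) pn0 => [|s IH] {}p.
  by rewrite leqn0 size_poly_eq0 => ->.
move=> sp pn0; have [[a pa]|nex] := pselect (exists a, root p a); last first.
  by exists [::] => x px; case: nex; exists x.
have [q qE] := factor_theorem p a pa.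
have qn0 : q != 0 by apply: contraNneq pn0 => q0; rewrite qE q0 mul0r.
have [|r rP] := IH q _ qn0.
  by move: sp; rewrite qE size_Mmonic ?monicXsubC // size_XsubC addn2.
exists (a :: r) => x; rewrite qE rootM root_XsubC inE => /orP[/rP ->|->] //.
by rewrite orbT.
Qed.

(** The square vanishes almost everywhere on [-1, 1]; for nonzero [p] this interval, of measure 2,
    would be covered by a null set and the finitely many roots of [p]. *)
Lemma itg_sqr_poly_eq0 (p : {poly R}) : itg (fun x => p.[x] ^+ 2) = 0 -> p = 0.
Proof.
have cp : continuous (fun x => p.[x] ^+ 2).
  by move=> x; apply: (@continuous_comp _ _ _ (horner p) (fun y => y ^+ 2));
    [exact: continuous_horner|exact: continuous_exprn].
move=> p0; apply: contraPeq p0 => pn0.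
have ip := continuous_integrable (-1) 1 cp.
have /integrableP[mf _] := ip.
move=> i0.
have iE : (\int[mu]_(x in `[(-1)%R, 1%R]) (p.[x] ^+ 2)%:E = 0)%E.
  by rewrite -(fineK (integrable_fin_num _ ip)) // [fine _]i0.
have : (\int[mu]_(x in `[(-1)%R, 1%R]) `|(p.[x] ^+ 2)%:E| = 0)%E.
  rewrite -iE; apply: eq_integral => x _.
  by rewrite /= ger0_norm ?sqr_ge0.
move/(ae_eq_integral_abs mu _ mf) => /(_ (measurable_itv _)) [N [mN N0 sub]].
have fr := finite_set_roots pn0.
have mr : measurable ([set x | root p x] : set R).
  by apply: countable_measurable => //; exact: finite_set_countable.
have m0 : mu [set x | root p x] = 0%E.
  by apply: countable_lebesgue_measure0; exact: finite_set_countable.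
have : (mu `[(-1)%R, 1%R] <= mu (N `|` [set x | root p x]))%E.
  apply: le_measure; rewrite ?inE //=.
    exact: measurableU.
  move=> x x1; have [px|px] := boolP (root p x); [by right|left].
  apply: sub => /= /(_ x1) /= /eqP; rewrite eqe sqrf_eq0 => h.
  by move: px; rewrite rootE h.
rewrite lebesgue_measure_itv /= lte_fin ifT; last lra.
move/le_trans => /(_ (mu N + mu [set x | root p x])%E).
rewrite measureU2 //.
rewrite m0 N0 adde0 => /(_ isT); rewrite -EFinB lee_fin; lra.
Qed.

End Integrals.

Section InnerProduct.
Variable R : realType.
Notation mu := (@lebesgue_measure R).
Implicit Types f g h : R -> R.

Lemma cont_cst (a : R) : continuous (fun _ : R => a).
Proof. by move=> x; exact: cvg_cst. Qed.

Lemma contD f g : continuous f -> continuous g -> continuous (fun x => f x + g x).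
Proof. by move=> cf cg x; apply: cvgD; [exact: cf|exact: cg]. Qed.

Lemma contB f g : continuous f -> continuous g -> continuous (fun x => f x - g x).
Proof. by move=> cf cg x; apply: cvgB; [exact: cf|exact: cg]. Qed.

Lemma contM f g : continuous f -> continuous g -> continuous (fun x => f x * g x).
Proof. by move=> cf cg x; apply: cvgM; [exact: cf|exact: cg]. Qed.

Lemma contZ a f : continuous f -> continuous (fun x => a * f x).
Proof. by move=> cf; apply: contM => //; exact: cont_cst. Qed.

Lemma cont_opp f : continuous f -> continuous (fun x => f (- x)).
Proof.
move=> cf x; apply: (@continuous_comp _ _ _ (@GRing.opp R) f); first exact: opp_continuous.
exact: cf.
Qed.

Lemma cont_horner (p : {poly R}) : continuous (fun x => p.[x]).
Proof. by move=> x; exact: continuous_horner. Qed.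

Notation ip := (L2dot `[-1, 1]).

Lemma ipE f g : ip f g = itg (fun x => f x * g x).
Proof. by []. Qed.

Lemma eq_ip f f' g g' : (forall x, -1 <= x <= 1 -> f x = f' x) ->
  (forall x, -1 <= x <= 1 -> g x = g' x) -> ip f g = ip f' g'.
Proof. by move=> ff gg; apply: eq_itg => x x1; rewrite ff ?gg. Qed.

Lemma ipC f g : ip f g = ip g f.
Proof. by apply: eq_itg => x _; rewrite mulrC. Qed.

Lemma ipDr f g h : continuous f -> continuous g -> continuous h ->
  ip f (fun x => g x + h x) = ip f g + ip f h.
Proof.
move=> cf cg ch; rewrite -itgD; [|exact: contM..].
by apply: eq_itg => x _; rewrite mulrDr.
Qed.

Lemma ipZr f g a : continuous f -> continuous g ->
  ip f (fun x => a * g x) = a * ip f g.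
Proof.
move=> cf cg; rewrite -itgZ; last exact: contM.
by apply: eq_itg => x _; rewrite mulrCA.
Qed.

Lemma ipBr f g h : continuous f -> continuous g -> continuous h ->
  ip f (fun x => g x - h x) = ip f g - ip f h.
Proof.
move=> cf cg ch; rewrite -(mulN1r (ip f h)) -ipZr // -ipDr //; last exact: contZ.
by apply: eq_ip => // x _; rewrite mulN1r.
Qed.

Lemma ip_sumr (I : Type) (s : seq I) f (g : I -> R -> R) : continuous f ->
  (forall i, continuous (g i)) ->
  ip f (fun x => \sum_(i <- s) g i x) = \sum_(i <- s) ip f (g i).
Proof.
move=> cf cg; have cs t : continuous (fun x => \sum_(i <- t) g i x).
  elim: t => [|i t IH].
    by under eq_fun do rewrite big_nil; exact: cont_cst.
  by under eq_fun do rewrite big_cons; exact: contD.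
elim: s => [|i s IH].
  rewrite big_nil -[RHS](mul0r (ip f f)) -ipZr //.
  by apply: eq_ip => // x _; rewrite big_nil mul0r.
rewrite big_cons -IH -ipDr //.
by apply: eq_ip => // x _; rewrite big_cons.
Qed.

Lemma ipN f g : continuous f -> continuous g ->
  ip (fun x => f (- x)) (fun x => g (- x)) = ip f g.
Proof. by move=> cf cg; rewrite !ipE -[RHS]itgN //; exact: contM. Qed.

Lemma ip_odd_even f g : continuous f -> continuous g ->
  (forall x, f (- x) = - f x) -> (forall x, g (- x) = g x) -> ip f g = 0.
Proof.
move=> cf cg fo ge; have := ipN cf cg.
have -> : ip (fun x => f (- x)) (fun x => g (- x)) = - ip f g.
  rewrite -(mulN1r (ip f g)) ipC [in RHS]ipC -ipZr //.
  by apply: eq_ip => // x _; rewrite ?ge // fo mulN1r.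
by lra.
Qed.

Lemma ip_norm_exprn (i j : nat) :
  ip (fun x : R => `|x| ^+ i) (fun x => `|x| ^+ j) = 2 / (i%:R + j%:R + 1).
Proof.
have e : (i%:R + j%:R + 1 : R) = (i + j).+1%:R by rewrite -addn1 !natrD.
rewrite ipE e.
by rewrite -(itg_norm_exprn R); apply: eq_itg => x _; rewrite exprD.
Qed.

Lemma ip_poly_eq0 (p : {poly R}) : ip (horner p) (horner p) = 0 -> p = 0.
Proof.
by move=> h; apply: itg_sqr_poly_eq0; rewrite -[RHS]h; apply: eq_itg => x _; rewrite expr2.
Qed.

Definition bub : {poly R} := 1 - 'X^2.

Lemma horner_bub x : bub.[x] = 1 - x ^+ 2.
Proof. by rewrite /bub hornerD hornerN hornerXn hornerC. Qed.

Lemma size_bub : size bub = 3%N.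
Proof. by rewrite /bub addrC size_polyDl size_polyN size_polyXn // size_poly1. Qed.

Lemma bub_neq0 : bub != 0. Proof. by rewrite -size_poly_eq0 size_bub. Qed.

Lemma bubble_bubM (N : nat) (q : {poly R}) : (0 < N)%N -> (size q <= N.-1)%N ->
  bubble N (bub * q).
Proof.
case: N => // N _ sq; split.
- have [->|q0] := eqVneq q 0; first by rewrite mulr0 size_poly0.
  by rewrite size_mul ?bub_neq0 // size_bub /= !addSn add0n /= !ltnS.
- by rewrite hornerM horner_bub expr1n subrr mul0r.
- by rewrite hornerM horner_bub sqrrN expr1n subrr mul0r.
Qed.

Lemma bubbleE (N : nat) (p : {poly R}) : bubble N p ->
  exists2 q : {poly R}, (size q <= N.-1)%N & p = bub * q.
Proof.
move=> [sp p1 pN1]; have [q1 qE] := factor_theorem p 1 (introT eqP p1).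
have /eqP q10 : q1.[-1] == 0.
  by move: pN1; rewrite qE hornerM hornerXsubC => /eqP;
    rewrite mulf_eq0 => /orP[//|/eqP]; lra.
have [q2 q2E] := factor_theorem q1 (-1) (introT eqP q10).
exists (- q2); last first.
  rewrite qE q2E /bub polyCN opprK; ring.
rewrite size_polyN; have [->|q20] := eqVneq q2 0; first by rewrite size_poly0.
move: sp; rewrite qE q2E !size_Mmonic ?monicXsubC ?mulf_neq0 ?polyXsubC_eq0 //.
by rewrite !size_XsubC !addnS !addn0 /=; case: N.
Qed.

(** The weight is (1 - t^2)^2, that of the ultraspherical polynomials of parameter 5 / 2; their
    orthogonality is thus the plain L2 orthogonality of the functions [phi0 j]. *)
Definition bub_form (p q : {poly R}) : R := ip (horner (bub * p)) (horner (bub * q)).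

Lemma bub_form_definite : definite_form bub_form.
Proof.
split.
- move=> p a q r; rewrite /bub_form -ipZr -?ipDr;
    try by [exact: cont_horner | apply: contZ; exact: cont_horner].
  by apply: eq_ip => // x _; rewrite !(hornerM, hornerD, hornerZ); ring.
- by move=> p q; exact: ipC.
- by move=> p /ip_poly_eq0 /eqP; rewrite mulf_eq0 (negbTE bub_neq0) => /eqP.
Qed.

(** Bubbles of degree at most [N] are the [bub * q] with [size q <= N.-1], so a projection exists as
    soon as the form sending [q] to <f, bub q> is represented in [bub_form]. *)
Lemma is_bubble_proj_bubble_proj (N : nat) f : (0 < N)%N -> continuous f ->
  is_bubble_proj N f (bubble_proj N f).
Proof.
move=> N0 cf; have [|p sp pP] := @poly_riesz _ _ (fun q => ip f (horner (bub * q))) N.-1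
  bub_form_definite.
  move=> a q r; rewrite -ipZr -?ipDr //; try by [exact: cont_horner | apply: contZ;
    exact: cont_horner].
  by apply: eq_ip => // x _; rewrite !(hornerM, hornerD, hornerZ); ring.
rewrite /bubble_proj; apply: (@xgetPex _ _ [set p | is_bubble_proj N f p]);
  exists (bub * p).
split; first exact: bubble_bubM.
move=> _ /bubbleE[q sq ->]; rewrite ipC ipBr; [|by [|exact: cont_horner]..].
by rewrite ipC -(pP q sq) /bub_form ipC subrr.
Qed.

Lemma cont_bubble_res N f : continuous f -> continuous (bubble_res N f).
Proof. by move=> cf; apply: contB => //; exact: cont_horner. Qed.

Lemma bubble_res_orth N f (q : {poly R}) : (0 < N)%N -> continuous f -> bubble N q ->
  ip (bubble_res N f) (horner q) = 0.
Proof. by move=> N0 cf bq; have [_ /(_ _ bq)] := is_bubble_proj_bubble_proj N0 cf. Qed.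

Lemma bubbleB N (p q : {poly R}) : bubble N p -> bubble N q -> bubble N (p - q).
Proof.
move=> [sp p1 pN1] [sq q1 qN1]; split;
  rewrite ?hornerD ?hornerN ?p1 ?q1 ?pN1 ?qN1 ?subr0 //.
by rewrite (leq_trans (size_polyD _ _)) // geq_max sp size_polyN.
Qed.

Lemma is_bubble_proj_inj N f (p q : {poly R}) : continuous f ->
  is_bubble_proj N f p -> is_bubble_proj N f q -> p = q.
Proof.
move=> cf [bp pP] [bq qP]; apply/eqP; rewrite -subr_eq0; apply/eqP/ip_poly_eq0.
have bpq := bubbleB bp bq.
have cfb r : continuous (fun t => f t - r.[t]) by apply: contB => //; exact: cont_horner.
transitivity (ip (horner (p - q)) (fun t => (f t - q.[t]) - (f t - p.[t]))).
  by apply: eq_ip => // x _; rewrite hornerD hornerN; ring.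
by rewrite ipBr //; [rewrite ipC qP // ipC pP // subrr|exact: cont_horner].
Qed.

Lemma bubble_compN N (p : {poly R}) : bubble N p -> bubble N (p \Po - 'X).
Proof.
move=> [sp p1 pN1]; split; rewrite ?horner_comp ?hornerN ?hornerX ?opprK //.
by rewrite size_comp_poly2 // size_polyN size_polyX.
Qed.

(** Reflection preserves bubbles, inner products and [f], so the reflected projection is again a
    projection of [f]; uniqueness concludes. *)
Lemma bubble_proj_even N f : (0 < N)%N -> continuous f -> (forall x, f (- x) = f x) ->
  bubble_proj N f \Po - 'X = bubble_proj N f.
Proof.
move=> N0 cf fe; have [bp pP] := is_bubble_proj_bubble_proj N0 cf.
apply: (is_bubble_proj_inj cf _ (is_bubble_proj_bubble_proj N0 cf)); split;
  first exact: bubble_compN.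
move=> q bq; have := pP _ (bubble_compN bq).
set p := bubble_proj N f; rewrite -ipN; first last.
- exact: cont_horner.
- by apply: contB => //; exact: cont_horner.
by move=> <-; apply: eq_ip => x _; rewrite ?fe !horner_comp hornerN hornerX ?opprK.
Qed.

Lemma ultraspherical_jacobi (n : nat) :
  is_monic_jacobi (5 / 2 - 1 / 2) (5 / 2 - 1 / 2) n (ultraspherical (5 / 2 : R) n).
Proof.
have [p [mp sp pP]] := orthogonal_poly_exists n bub_form_definite.
rewrite /ultraspherical /jacobi.
apply: (@xgetPex _ _ [set p | is_monic_jacobi _ _ n p]); exists p; split => // q sq.
rewrite -[RHS](pP q sq); apply: eq_itg => x /andP[x1 x2].
(* The exponent is the integer 2, so on [-1, 1] the real powers are squares and their product is the
   square of [bub]. *)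
have -> : 5 / 2 - 1 / 2 = 2%:R :> R by lra.
rewrite !powR_mulrn; [|lra..].
by rewrite !hornerM horner_bub; ring.
Qed.

Lemma ultraspherical_orth (n : nat) (q : {poly R}) : (size q <= n)%N ->
  bub_form (ultraspherical (5 / 2) n) q = 0.
Proof.
move=> sq; have [_ _ /(_ q sq) h] := ultraspherical_jacobi n.
rewrite -[RHS]h; apply: eq_itg => x /andP[x1 x2].
have -> : 5 / 2 - 1 / 2 = 2%:R :> R by lra.
rewrite !powR_mulrn; [|lra..].
by rewrite !hornerM horner_bub; ring.
Qed.

Definition phi0_poly (j : nat) : {poly R} := bub * ultraspherical (5 / 2) (j - 2).

Lemma phi0E j t : phi0 j t = (phi0_poly j).[t].
Proof. by rewrite /phi0_poly hornerM horner_bub. Qed.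

Lemma phi0_bubble N j : (0 < N)%N -> (2 <= j <= N)%N -> bubble N (phi0_poly j).
Proof.
move=> N0 /andP[j2 jN]; apply: bubble_bubM => //.
have [_ -> _] := ultraspherical_jacobi (j - 2).
by case: j j2 jN => [|[|j]] // _; case: N {N0} => // N; rewrite subSS subSS subn0 ltnS.
Qed.

Lemma ip_phi0_neq i j : (2 <= i)%N -> (2 <= j)%N -> i != j ->
  ip (horner (phi0_poly i)) (horner (phi0_poly j)) = 0.
Proof.
move=> i2 j2 ij; rewrite -[LHS]/(bub_form _ _).
have [si sj] : size (ultraspherical (5 / 2 : R) (i - 2)) = (i - 2).+1 /\
    size (ultraspherical (5 / 2 : R) (j - 2)) = (j - 2).+1.
  by have [_ -> _] := ultraspherical_jacobi (i - 2);
    have [_ -> _] := ultraspherical_jacobi (j - 2).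
have [ltij|ltji|/eqP] := ltngtP i j; last by rewrite (negbTE ij).
  have [_ -> _] := bub_form_definite; apply: ultraspherical_orth; rewrite si.
  by rewrite ltn_sub2r // (leq_ltn_trans i2).
by apply: ultraspherical_orth; rewrite sj ltn_sub2r // (leq_ltn_trans j2).
Qed.

Lemma phi0_poly_neq0 j : phi0_poly j != 0.
Proof.
by rewrite mulf_neq0 ?bub_neq0 // monic_neq0 //; have [] := ultraspherical_jacobi (j - 2).
Qed.

Lemma phi0_span (N : nat) (p : {poly R}) : bubble N p ->
  exists c : nat -> R, p = \sum_(2 <= j < N.+1) c j *: phi0_poly j.
Proof.
move=> /bubbleE[q sq ->].
have [|c qE] := @monic_family_span _ _ (fun j => ultraspherical (5 / 2 : R) j) q _ sq.
  by move=> j _; have [] := ultraspherical_jacobi j.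
exists (fun j => c (j - 2)%N); rewrite qE mulr_sumr.
case: N sq qE => [|N] sq qE /=; first by rewrite big_ord0 big_geq.
case: N sq qE => [|N] sq qE /=; first by rewrite big_ord0 big_geq.
rewrite (big_addn 0 _ 2) subSS subSS subn0 big_mkord; apply: eq_bigr => j _.
by rewrite /phi0_poly addnK scalerAr.
Qed.

End InnerProduct.

(** * Moments of the residuals *)

Section Residuals.
Variables (R : realType) (n : nat).
Notation ip := (@L2dot R `[-1, 1]).
Notation N := (4 * n + 1)%N.
Notation m := (2 * n).+1.
Implicit Types f g h : R -> R.

(** With the absolute value every exponent gives an even function, and the moments have one formula
    whatever the parity of the exponent. *)
Definition nexp (k : nat) (t : R) : R := `|t| ^+ k.

Lemma cont_nexp k : continuous (nexp k).
Proof. exact: continuous_norm_exprn. Qed.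

Lemma ip_nexp i j : ip (nexp i) (nexp j) = 2 / (i%:R + j%:R + 1).
Proof. exact: ip_norm_exprn. Qed.

Lemma nexp_even k t : nexp k (- t) = nexp k t.
Proof. by rewrite /nexp normrN. Qed.

Lemma nexp_double k t : nexp (2 * k) t = t ^+ (2 * k).
Proof. by rewrite /nexp !exprM real_normK ?num_real. Qed.

Lemma N_gt0 : (0 < N)%N. Proof. by rewrite addn1. Qed.

(** Even polynomials are stored as polynomials in t^2: degree at most 4 n becomes at most 2 n + 1
    coefficients, one for each even node. *)
Definition evfun (q : {poly R}) (t : R) : R := q.[t ^+ 2].

Lemma cont_evfun q : continuous (evfun q).
Proof.
move=> x; apply: (@continuous_comp _ _ _ (fun t : R => t ^+ 2) (horner q)).
  exact: continuous_exprn.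
exact: continuous_horner.
Qed.

Lemma evfunE (q : {poly R}) t : (size q <= m)%N ->
  evfun q t = \sum_(k < m) q`_k * nexp (2 * k) t.
Proof.
move=> sq; rewrite /evfun (horner_coef_wide _ sq); apply: eq_bigr => k _.
by rewrite nexp_double exprM.
Qed.

Lemma evfun1 (q : {poly R}) : (size q <= m)%N -> evfun q 1 = \sum_(k < m) q`_k.
Proof.
move=> sq; rewrite evfunE //; apply: eq_bigr => k _.
by rewrite /nexp normr1 expr1n mulr1.
Qed.

Lemma ip_evfun f (q : {poly R}) : continuous f -> (size q <= m)%N ->
  ip f (evfun q) = \sum_(k < m) q`_k * ip f (nexp (2 * k)).
Proof.
move=> cf sq; have ce := cont_nexp.
transitivity (ip f (fun t => \sum_(k < m) q`_k * nexp (2 * k) t)).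
  by apply: eq_ip => // x _; exact: evfunE.
rewrite ip_sumr //; last by move=> k; exact: contZ.
by apply: eq_bigr => k _; rewrite ipZr.
Qed.

Lemma ip_lin f g h a b : continuous f -> continuous g -> continuous h ->
  ip f (fun t => a * g t + b * h t) = a * ip f g + b * ip f h.
Proof. by move=> cf cg ch; rewrite -!ipZr // -ipDr //; exact: contZ. Qed.

(** In the variable [s], the even nodes are the exponents where moments are prescribed; the moment
    of t^(2 k) is 2 / (s + 2 k + 1), so the poles are the negatives of the [exp_node]. *)
Definition even_node (k : 'I_m) : R := (2 * k)%:R.
Definition exp_node (k : 'I_m) : R := (2 * k)%:R + 1.

Lemma ip_evfun_nexp (q : {poly R}) (s : nat) : (size q <= m)%N ->
  ip (evfun q) (nexp s) = \sum_(k < m) (2 * q`_k) / (s%:R + exp_node k).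
Proof.
move=> sq; rewrite ipC ip_evfun //; last exact: cont_nexp.
by apply: eq_bigr => k _; rewrite ip_nexp /exp_node addrA; ring.
Qed.

Lemma even_node_inj : injective even_node.
Proof. by move=> i j /eqP; rewrite /even_node eqr_nat eqn_mul2l /= => /eqP/val_inj. Qed.

Lemma nat_exp_node (s : nat) k : s%:R + exp_node k != 0.
Proof. by rewrite /exp_node addrA -natrD natr1 pnatr_eq0. Qed.

(** The summands are 4 k + 1 for k up to 2 n. The total is the constant [K] that becomes the
    denominator of <r0e, 1>. *)
Lemma sum_nodes : \sum_k exp_node k + \sum_j even_node j = (2 * n%:R + 1) * (4 * n%:R + 1).
Proof.
rewrite /exp_node /even_node -big_split /=.
have H j : \sum_(i < j.+1) ((2 * i)%:R + 1 + (2 * i)%:R) = (j.+1%:R) * (2 * j%:R + 1) :> R.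
  elim: j => [|j IH]; first by rewrite big_ord1 /= muln0; ring.
  by rewrite big_ord_recr IH /= !natrM -!natr1; ring.
by rewrite H -natr1 natrM; ring.
Qed.

Notation p0 := (bubble_proj N (fun t : R => 1 + t)).
Notation P0 := (1 + 'X - p0).

Lemma cont_1x : continuous (fun t : R => 1 + t).
Proof. by apply: contD; [exact: cont_cst|move=> x; exact: cvg_id]. Qed.

Lemma cont_r0 : continuous (@r0 R N).
Proof. exact: cont_bubble_res cont_1x. Qed.

Lemma size_P0 : (size P0 <= N.+1)%N.
Proof.
have [[sp _ _] _] := is_bubble_proj_bubble_proj N_gt0 cont_1x.
rewrite (leq_trans (size_polyD _ _)) // geq_max size_polyN sp andbT.
rewrite addrC -[1]opprK -polyCN size_XsubC; lia.
Qed.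

Lemma r0_1 : @r0 R N 1 = 2.
Proof.
have [[_ p1 _] _] := is_bubble_proj_bubble_proj N_gt0 cont_1x.
by rewrite /r0 /bubble_res p1; ring.
Qed.

Lemma r0_N1 : @r0 R N (-1) = 0.
Proof.
have [[_ _ p1] _] := is_bubble_proj_bubble_proj N_gt0 cont_1x.
by rewrite /r0 /bubble_res p1; ring.
Qed.

Notation Pe := (even_poly P0).
Notation Po := (odd_poly P0).

Definition r0e := evfun Pe.
Definition r0o t := t * evfun Po t.

Lemma horner_even_odd (p : {poly R}) t :
  p.[t] = evfun (even_poly p) t + t * evfun (odd_poly p) t.
Proof.
by rewrite -{1}(poly_even_odd p) hornerD hornerM !horner_comp hornerXn hornerX mulrC.
Qed.

Lemma evfunN q t : evfun q (- t) = evfun q t.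
Proof. by rewrite /evfun sqrrN. Qed.

Lemma r0oN t : r0o (- t) = - r0o t.
Proof. by rewrite /r0o evfunN mulNr. Qed.

Lemma r0E t : r0 N t = r0e t + r0o t.
Proof. by rewrite /r0e /r0o -horner_even_odd !hornerE. Qed.

Lemma r0NE t : r0 N (- t) = r0e t - r0o t.
Proof. by rewrite r0E /r0e /r0o !evfunN mulNr. Qed.

Lemma cont_r0e : continuous r0e. Proof. exact: cont_evfun. Qed.

Lemma cont_r0o : continuous r0o.
Proof. by apply: contM; [move=> x; exact: cvg_id|exact: cont_evfun]. Qed.

Lemma r0_orth (q : {poly R}) : bubble N q -> ip (r0 N) (horner q) = 0.
Proof. exact: bubble_res_orth N_gt0 cont_1x. Qed.

Lemma r0N_orth (q : {poly R}) : bubble N q -> ip (fun t => r0 N (- t)) (horner q) = 0.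
Proof.
move=> bq; rewrite -(r0_orth (bubble_compN bq)) -[RHS]ipN;
  [|exact: cont_r0|exact: cont_horner].
by apply: eq_ip => // x _; rewrite horner_comp hornerN hornerX opprK.
Qed.

Lemma r0e_orth (q : {poly R}) : bubble N q -> ip r0e (horner q) = 0.
Proof.
move=> bq; have cq := @cont_horner R q; have cr := cont_r0.
have -> : ip r0e (horner q) = ip (horner q) (fun t => 2^-1 * r0 N t + 2^-1 * r0 N (- t)).
  by rewrite ipC; apply: eq_ip => // x _; rewrite r0NE r0E; field.
rewrite (ip_lin _ _ cq cr (cont_opp cr)).
by rewrite ![ip (horner q) _]ipC r0_orth // r0N_orth // !mulr0 addr0.
Qed.

Lemma r0o_orth (q : {poly R}) : bubble N q -> ip r0o (horner q) = 0.
Proof.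
move=> bq; have cq := @cont_horner R q; have cr := cont_r0.
have -> : ip r0o (horner q) = ip (horner q) (fun t => 2^-1 * r0 N t + (- 2^-1) * r0 N (-
  t)).
  by rewrite ipC; apply: eq_ip => // x _; rewrite r0NE r0E; field.
rewrite (ip_lin _ _ cq cr (cont_opp cr)).
by rewrite ![ip (horner q) _]ipC r0_orth // r0N_orth // !mulr0 addr0.
Qed.

Lemma r0e_1 : r0e 1 = 1.
Proof. by have := r0NE 1; have := r0E 1; rewrite r0_1 r0_N1; lra. Qed.

Lemma r0o_1 : r0o 1 = 1.
Proof. by have := r0NE 1; have := r0E 1; rewrite r0_1 r0_N1; lra. Qed.

Lemma size_Pe : (size Pe <= m)%N.
Proof. by rewrite (leq_trans (size_even_poly _)) //; have := size_P0; lia. Qed.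

Lemma size_Po : (size Po <= m)%N.
Proof. by rewrite (leq_trans (size_odd_poly _)) //; have := size_P0; lia. Qed.

(** Orthogonality to these bubbles makes the moments of a residual against 1, t^2, ..., t^(4 n) all
    equal; [bubble_odd] does the same for t, t^3, ..., t^(4 n + 1). *)
Lemma bubble_even j : (j < m)%N -> bubble N (1 - 'X^(2 * j) : {poly R}).
Proof.
move=> jm; split; rewrite ?hornerE ?expr1n ?subrr //.
  rewrite (leq_trans (size_polyD _ _)) // geq_max size_polyN size_poly1 size_polyXn; lia.
by rewrite exprM sqrrN !expr1n subrr.
Qed.

Lemma bubble_odd j : (j < m)%N -> bubble N ('X - 'X^((2 * j).+1) : {poly R}).
Proof.
move=> jm; split; rewrite ?hornerE ?expr1n ?subrr //.
  rewrite (leq_trans (size_polyD _ _)) // geq_max size_polyN size_polyX size_polyXn; lia.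
by rewrite exprS exprM sqrrN !expr1n mulr1 subrr.
Qed.

Lemma ip_r0e_nexp j : (j < m)%N -> ip r0e (nexp (2 * j)) = ip r0e (nexp 0).
Proof.
move=> jm; apply/eqP; rewrite eq_sym -subr_eq0 -ipBr; [|exact: cont_r0e|exact: cont_nexp..].
rewrite -(r0e_orth (bubble_even jm)); apply/eqP; apply: eq_ip => // x _.
by rewrite nexp_double !hornerE /nexp expr0.
Qed.

Let K : R := (2 * n%:R + 1) * (4 * n%:R + 1).
Let K' : R := (2 * n%:R + 1) * (4 * n%:R + 3).

Let n0 : (0 : R) <= n%:R. Proof. exact: ler0n. Qed.

Let K_gt0 : 0 < K. Proof. by apply: mulr_gt0; have := n0; lra. Qed.
Let K'_gt0 : 0 < K'. Proof. by apply: mulr_gt0; have := n0; lra. Qed.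

(** The moments of [r0e] take a single value c at all even nodes, and the residues 2 Pe_k add up to
    2 r0e(1) = 2. Hence [sum_coef_pf_const] reads 2 = c K. *)
Lemma ip_r0e_1 : ip r0e (nexp 0) = 2 / K.
Proof.
have := @sum_coef_pf_const R (2 * n)%N exp_node even_node (fun k => 2 * Pe`_k) (ip r0e
  (nexp 0)).
rewrite -mulr_sumr -(evfun1 size_Pe) -/r0e r0e_1 sum_nodes -/K mulr1 => -> //.
- by field; rewrite gt_eqF.
- exact: even_node_inj.
- by move=> j k; exact: nat_exp_node.
- move=> j; rewrite -(@ip_r0e_nexp j) //; exact/esym/(ip_evfun_nexp _ size_Pe).
Qed.

(** Expand one factor in even powers: each has the same product with [r0e], and the coefficients add
    up to r0e(1) = 1. *)
Lemma ip_r0e_r0e : ip r0e r0e = 2 / K.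
Proof.
rewrite {2}/r0e ip_evfun ?size_Pe //; last exact: cont_r0e.
have r1 : evfun Pe 1 = 1 := r0e_1.
rewrite -ip_r0e_1 -[RHS]mul1r -[X in _ = X * _]r1 evfun1 ?size_Pe // mulr_suml.
by apply: eq_bigr => k _; rewrite ip_r0e_nexp.
Qed.

(** The two odd factors t merge into t^2, so odd moments of [r0o] are even moments of its cofactor
    at nodes shifted by 2. This is why [K'] exceeds [K] by 2 (2 n + 1). *)
Lemma ip_r0o_t j : ip r0o (fun t => t * nexp (2 * j) t) = ip (evfun Po) (nexp (2 * j).+2).
Proof.
have e : (2 * j).+2 = (2 * j.+1)%N by lia.
by apply: eq_itg => x _; rewrite /r0o e !nexp_double -e !exprS; ring.
Qed.

Lemma ip_r0o_nexp j : (j < m)%N ->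
  ip r0o (fun t => t * nexp (2 * j) t) = ip r0o id.
Proof.
have cid : continuous (fun t : R => t) by move=> x; exact: cvg_id.
move=> jm; apply/eqP; rewrite eq_sym -subr_eq0 -ipBr //;
  [|exact: cont_r0o|exact: contM (@cont_nexp _)].
rewrite -(r0o_orth (bubble_odd jm)); apply/eqP; apply: eq_ip => // x _.
by rewrite nexp_double !hornerE exprS.
Qed.

Lemma ip_r0o_id : ip r0o id = 2 / K'.
Proof.
have := @sum_coef_pf_const R (2 * n)%N exp_node (fun k => even_node k + 2) (fun k => 2 *
  Po`_k) (ip r0o id).
have r1 : evfun Po 1 = 1 by have := r0o_1; rewrite /r0o mul1r.
rewrite -mulr_sumr -(evfun1 size_Po) r1 [\sum_j (even_node j + 2)]big_split /= addrA
  sum_nodes mulr1.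
rewrite sumr_const card_ord.
have -> : (2 * n%:R + 1) * (4 * n%:R + 1) + 2 *+ m = K'.
  by rewrite -(mulr_natr 2 m) -(natr1 (2 * n)) (natrM _ 2 n) /K'; ring.
have yE (j : 'I_m) : even_node j + 2 = (2 * j).+2%:R by rewrite /even_node -natrD addn2.
move=> -> //.
- by field; rewrite gt_eqF.
- by move=> i j /addIr; exact: even_node_inj.
- by move=> j k; rewrite yE; exact: nat_exp_node.
- move=> j; rewrite yE -(@ip_r0o_nexp j) // ip_r0o_t; exact/esym/(ip_evfun_nexp _ size_Po).
Qed.

Lemma ip_r0o_r0o : ip r0o r0o = 2 / K'.
Proof.
have cid : continuous (fun t : R => t) by move=> x; exact: cvg_id.
have cn := cont_nexp; have co := cont_r0o.
transitivity (ip r0o (fun t => \sum_(k < m) Po`_k * (t * nexp (2 * k) t))).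
  apply: eq_ip => // x _; rewrite {1}/r0o evfunE ?size_Po // mulr_sumr.
  by apply: eq_bigr => k _; ring.
rewrite ip_sumr //; last by move=> k; apply: contZ; exact: contM.
have r1 : evfun Po 1 = 1 by have := r0o_1; rewrite /r0o mul1r.
rewrite -ip_r0o_id -[RHS]mul1r -[X in _ = X * _]r1 evfun1 ?size_Po // mulr_suml.
by apply: eq_bigr => k _; rewrite ipZr ?ip_r0o_nexp //; exact: contM.
Qed.

Lemma ip_r0e_r0o : ip r0e r0o = 0.
Proof.
by rewrite ipC ip_odd_even //; [exact: cont_r0o|exact: cont_r0e|exact: r0oN|exact: evfunN].
Qed.

(* The coefficient [A_s] of the header. *)
Definition muntz_factor (s : nat) : R :=
  \prod_(k < m) ((s%:R - (2 * k)%:R) / (s%:R + (2 * k)%:R + 1)).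

Lemma muntz_factor_even j : (j < m)%N -> muntz_factor (2 * j) = 0.
Proof. by move=> jm; rewrite /muntz_factor (bigD1 (Ordinal jm)) //= subrr !mul0r. Qed.

Section OddM.
Variable M : nat.
Hypothesis oddM : odd M.
Notation pM := (bubble_proj N (@ubar R M)).
Definition uM : R -> R := bubble_res N (ubar M).

(** As [M - 1] is even, t^(M - 1) is |t|^(M - 1). *)
Lemma ubarE t : ubar M t = 1 - nexp M t.
Proof.
rewrite /ubar oddM /nexp; case: (M) oddM => // k ok; rewrite subSS subn0 exprS.
congr (_ - _ * _); have /even_halfK e : ~~ odd k by [].
by rewrite -e -muln2 mulnC !exprM real_normK ?num_real.
Qed.

Lemma cont_ubar : continuous (@ubar R M).
Proof.
have -> : @ubar R M = (fun t => 1 - nexp M t) by apply/funext => t; exact: ubarE.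
by apply: contB; [exact: cont_cst|exact: cont_nexp].
Qed.

Lemma cont_uM : continuous uM.
Proof. exact: cont_bubble_res cont_ubar. Qed.

Lemma uM_orth (q : {poly R}) : bubble N q -> ip uM (horner q) = 0.
Proof. exact: bubble_res_orth N_gt0 cont_ubar. Qed.

Lemma uME t : uM t = evfun (1 - even_poly pM) t - nexp M t.
Proof.
have eN : pM \Po - 'X = pM.
  by apply: bubble_proj_even N_gt0 cont_ubar _ => x; rewrite !ubarE nexp_even.
have pE : pM.[t] = evfun (even_poly pM) t.
  have := congr1 (horner^~ t) eN; rewrite horner_comp hornerN hornerX.
  by rewrite !(horner_even_odd pM) !evfunN; lra.
by rewrite /uM /bubble_res ubarE pE /evfun hornerD hornerN hornerC; ring.
Qed.

Lemma uM_even t : uM (- t) = uM t.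
Proof. by rewrite !uME evfunN nexp_even. Qed.

Lemma uM_1 : uM 1 = 0.
Proof.
have [[_ p1 _] _] := is_bubble_proj_bubble_proj N_gt0 cont_ubar.
by rewrite /uM /bubble_res p1 ubarE /nexp normr1 expr1n; ring.
Qed.

Lemma ip_uM_nexp j : (j < m)%N -> ip uM (nexp (2 * j)) = ip uM (nexp 0).
Proof.
move=> jm; apply/eqP; rewrite eq_sym -subr_eq0 -ipBr; [|exact: cont_uM|exact: cont_nexp..].
rewrite -(uM_orth (bubble_even jm)); apply/eqP; apply: eq_ip => // x _.
by rewrite nexp_double !hornerE /nexp expr0.
Qed.

(** The remainder [v] has 2 n + 1 vanishing moments, and its moment function has 2 n + 2 poles, so
    it is known up to a factor. That factor is 2 v(1), while the residue at the pole contributed by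
    |t|^M is 2; comparing the two determines everything. *)
Lemma muntz_remainder : exists q : {poly R}, [/\ (size q <= m)%N,
  forall t, uM t = muntz_factor M * r0e t - (evfun q t + nexp M t) &
  forall s, ip (nexp s) (fun t => evfun q t + nexp M t) =
    2 * muntz_factor M * muntz_factor s / (s%:R + M%:R + 1)].
Proof.
(* As <r0e, 1> = 2 / K, this makes [uM] and [k * r0e] have the same integral, hence the same moments
   at all even nodes. *)
pose k := ip uM (nexp 0) / (2 / K).
pose q := k *: Pe - (1 - even_poly pM); pose v t := evfun q t + nexp M t.
have sp : (size (even_poly pM) <= m)%N.
  have [[sp _ _] _] := is_bubble_proj_bubble_proj N_gt0 cont_ubar.
  by rewrite (leq_trans (size_even_poly _)) //; lia.
have sq : (size q <= m)%N.
  rewrite (leq_trans (size_polyD _ _)) // geq_max size_polyN.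
  rewrite (leq_trans (size_scale_leq _ _)) ?size_Pe //=.
  by rewrite (leq_trans (size_polyD _ _)) // geq_max size_polyN size_poly1 sp.
have uE t : uM t = k * r0e t - v t.
  by rewrite uME /v /q /evfun !hornerE /r0e /evfun; ring.
have v1 : v 1 = k by have := uE 1; rewrite uM_1 r0e_1; lra.
have cv : continuous v by apply: contD; [exact: cont_evfun|exact: cont_nexp].
have vorth j : (j < m)%N -> ip v (nexp (2 * j)) = 0.
  move=> jm; have vE t : v t = k * r0e t - uM t by rewrite uE; ring.
  transitivity (ip (nexp (2 * j)) (fun t => k * r0e t - uM t)).
    by rewrite ipC; apply: eq_ip.
  have cn := cont_nexp; have ce := cont_r0e; have cu := cont_uM.
  rewrite ipBr ?ipZr //; last exact: contZ.
  rewrite !(ipC (nexp _)) ip_r0e_nexp // ip_uM_nexp // ip_r0e_1 /k.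
  by field; rewrite gt_eqF.
have ipv s : ip v (nexp s) =
    \sum_(i < m) (2 * q`_i) / (s%:R + exp_node i) + 2 / (s%:R + (M%:R + 1)).
  have cn := cont_nexp; have ce := @cont_evfun q.
  rewrite ipC ipDr // ipC ip_evfun_nexp // ip_nexp addrA //.
have Mexp s : s%:R + (M%:R + 1) != 0 :> R by rewrite addrA -natrD natr1 pnatr_eq0.
(* The distinguished residue is the 2 of |t|^M, at the pole - (M + 1). *)
have := @pf_vanishing R (2 * n)%N exp_node even_node (fun i => 2 * q`_i) 2 (M%:R + 1)
  even_node_inj.
case=> [||j|].
- by move=> j i; exact: nat_exp_node.
- by move=> j; exact: Mexp.
- by rewrite -ipv vorth.
rewrite -mulr_sumr -(evfun1 sq).
have -> : 2 * evfun q 1 + 2 = 2 * k.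
  by rewrite -v1 /v /nexp normr1 expr1n; ring.
move=> kE vals.
(* The residue identity at - (M + 1), with both sides divided by 2; numerators and denominators
   change sign together, factor by factor. *)
have kM : k = muntz_factor M.
  have E : \prod_(i < m) (exp_node i - (M%:R + 1)) = k * \prod_(j < m) (- (M%:R + 1) -
    even_node j).
    have t0 : (2 : R) != 0 by rewrite pnatr_eq0.
    by have := kE; rewrite -mulrA => /(mulfI t0).
  have D0 : \prod_(j < m) (- (M%:R + 1) - even_node j) != 0.
    apply/prodf_neq0 => j _; rewrite -opprD oppr_eq0 /even_node.
    by rewrite natr1 -natrD pnatr_eq0.
  apply: (mulIf D0); rewrite -E /muntz_factor -big_split /=.
  apply: eq_bigr => i _; rewrite /exp_node /even_node.
  have := nat_exp_node M i; rewrite /exp_node addrA => ?; field.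
  by [].
exists q; split => // [t|s]; first by rewrite -kM.
rewrite ipC ipv vals //; [|by move=> i; exact: nat_exp_node].
rewrite -kM /muntz_factor prodf_div.
have -> : \prod_(i < m) (s%:R + exp_node i) = \prod_(i < m) (s%:R + (2 * i)%:R + 1).
  by apply: eq_bigr => i _; rewrite /exp_node addrA.
have : \prod_(i < m) (s%:R + (2 * i)%:R + 1) != 0 :> R.
  by apply/prodf_neq0 => i _; rewrite -natrD natr1 pnatr_eq0.
by have := Mexp s; rewrite addrA => ? ?; rewrite /even_node; field; apply/andP.
Qed.

End OddM.

End Residuals.

(** * Closed forms of the coefficients A_1 and A_(2n-1) *)

Section Constants.
Variable R : realType.

(** The product is the double factorial (2 j - 1)!!. *)
Lemma odd_prod_factorial j :
  \prod_(i < j) (2 * i%:R + 1) * (2 ^+ j * j`!%:R) = (2 * j)`!%:R :> R.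
Proof.
elim: j => [|j IH]; first by rewrite big_ord0 muln0 /= expr0 !mul1r.
have -> : (2 * j.+1 = (2 * j).+2)%N by lia.
rewrite big_ord_recr /= !factS !natrM -IH exprS -!natr1 natrM; ring.
Qed.

Lemma muntz_factor_1 n : muntz_factor R n 1 =
  (4 * n)`!%:R / (2 * 16 ^+ n * (2 * n)`!%:R * (2 * n).+1`!%:R).
Proof.
(* The length of the product is freed from [n] for the induction; the sign disappears since it is
   used at the even value j = 2 n. *)
have H j : \prod_(k < j.+1) ((1%:R - (2 * k)%:R) / (1%:R + (2 * k)%:R + 1)) =
    (-1) ^+ j * (2 * j)`!%:R / (4 ^+ j * j`!%:R * 2 * j.+1`!%:R) :> R.
  elim: j => [|j IH]; first by rewrite big_ord1 /= muln0 (factS 0) fact0 !expr0; field.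
  have F1 : (2 * j.+1)`!%:R = (2 * j%:R + 2) * (2 * j%:R + 1) * (2 * j)`!%:R :> R.
    by rewrite (_ : 2 * j.+1 = (2 * j).+2)%N ?factS ?natrM -?(natr1 (2 * j).+1) -?(natr1
      (2 * j)) ?natrM; [ring|lia].
  have F2 k : k.+1`!%:R = (k%:R + 1) * k`!%:R :> R by rewrite factS natrM -natr1.
  rewrite big_ord_recr IH /= F1 (F2 j.+1) (F2 j) natrM -(natr1 j) !exprS.
  have f1 : (j`!%:R : R) != 0 by rewrite pnatr_eq0 -lt0n fact_gt0.
  have f2 : (4 : R) ^+ j != 0 by rewrite expf_neq0.
  have j0 : (0 : R) <= j%:R by exact: ler0n.
  field; rewrite f1 f2 /=; apply/andP; split; rewrite gt_eqF //; lra.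
rewrite /muntz_factor H exprM sqrrN !expr1n mul1r; congr (_ / _).
  by congr _`!%:R; lia.
have -> : (4 : R) ^+ (2 * n) = 16 ^+ n by rewrite exprM; congr (_ ^+ _); ring.
ring.
Qed.

Lemma prod_even_factorial p j :
  \prod_(k < j) (2 * p%:R + 2 + 2 * k%:R) * p`!%:R = 2 ^+ j * (p + j)`!%:R :> R.
Proof.
elim: j => [|j IH]; first by rewrite big_ord0 addn0 expr0 !mul1r.
rewrite big_ord_recr /= addnS factS natrM exprS mulrAC IH -(natr1 (p + j)) natrD; ring.
Qed.

(** The numerators are the odd numbers from 2 n - 1 down to - (2 n + 1): n positive ones give (2 n -
    1)!!, and n + 1 negative ones give (2 n + 1)!! and the sign. The denominators are the even
    numbers from 2 n to 6 n. *)
Lemma muntz_factor_mid n : (0 < n)%N ->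
  muntz_factor R n (2 * n - 1) * ((2 ^+ (2 * n).+1) ^+ 2 * n`!%:R * n.+1`!%:R * (3 *
    n)`!%:R) =
  (-1) ^+ n.+1 * ((2 * n)`!%:R * (2 * n.+1)`!%:R * n.-1`!%:R).
Proof.
case: n => // p _; set n := p.+1.
rewrite -(odd_prod_factorial n) -(odd_prod_factorial n.+1) /muntz_factor prodf_div.
have mE : (2 * n - 1 = 2 * p + 1)%N by rewrite /n; lia.
have nE : n%:R = p%:R + 1 :> R by rewrite natr1.
have num : \prod_(k < (2 * n).+1) ((2 * n - 1)%:R - (2 * k)%:R) =
    (-1) ^+ n.+1 * (\prod_(i < n) (2 * i%:R + 1) * \prod_(i < n.+1) (2 * i%:R + 1)) :> R.
  rewrite mE; have -> : (2 * n).+1 = (n + n.+1)%N by lia.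
  rewrite big_split_ord /= mulrCA; congr (_ * _).
    rewrite (reindex_inj rev_ord_inj) /=; apply: eq_bigr => i _.
    rewrite !natrM natrD natrB ?ltn_ord // natrM nE -(natr1 i); ring.
  rewrite -[in (-1) ^+ _](card_ord n.+1) -prodrN; apply: eq_bigr => i _.
  rewrite !(natrD, natrM) nE; ring.
have den : \prod_(k < (2 * n).+1) ((2 * n - 1)%:R + (2 * k)%:R + 1) * p`!%:R =
    2 ^+ (2 * n).+1 * (3 * n)`!%:R :> R.
  have -> : (3 * n = p + (2 * n).+1)%N by rewrite /n; lia.
  rewrite -prod_even_factorial; congr (_ * _); apply: eq_bigr => i _.
  rewrite mE !(natrD, natrM); ring.
have d0 : \prod_(k < (2 * n).+1) ((2 * n - 1)%:R + (2 * k)%:R + 1) != 0 :> R.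
  by apply/prodf_neq0 => i _; rewrite -natrD natr1 pnatr_eq0.
have e : (2 : R) ^+ (2 * n).+1 = 2 ^+ n * 2 ^+ n.+1 by rewrite -exprD; congr (_ ^+ _); lia.
rewrite num {1}expr2 [n.-1]/= .
set D := \prod_(k < _) _ in den d0 *; set A := \prod_(i < _) _; set B := \prod_(i < _) _.
transitivity ((-1) ^+ n.+1 * (A * B) / D * (2 ^+ (2 * n).+1 * n`!%:R * n.+1`!%:R * (2 ^+
  (2 * n).+1 * (3 * n)`!%:R))).
  by ring.
by rewrite -den e; field.
Qed.

(** Divided by A_1, this is the double root x = - (4 n - 1) / 3. It removes [alpha] from the later
    identities, which become rational in [n] and A_1. *)
Lemma alpha_muntz_factor n : (0 < n)%N ->
  alpha n * muntz_factor R n (2 * n - 1) = - ((4 * n%:R - 1) / 3) * muntz_factor R n 1.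
Proof.
move=> n0; have f0 k : (k`!%:R : R) != 0 by rewrite pnatr_eq0 -lt0n fact_gt0.
have two k : (2 : R) ^+ k != 0 by rewrite expf_neq0.
have sixteen : (2 ^+ (2 * n).+1) ^+ 2 = 4 * 16 ^+ n :> R.
  have -> : 16 = (2 ^+ 2) ^+ 2 :> R by ring.
  by rewrite (exprS _ (2 * n)) (exprM _ 2 n) exprMn -!(exprM (2 ^+ 2)) (mulnC n);
    congr (_ * _); ring.
have s0 : (16 : R) ^+ n != 0 by rewrite expf_neq0.
have -> : muntz_factor R n (2 * n - 1) =
   (-1) ^+ n.+1 * ((2 * n)`!%:R * (2 * n.+1)`!%:R * n.-1`!%:R) /
   ((2 ^+ (2 * n).+1) ^+ 2 * n`!%:R * n.+1`!%:R * (3 * n)`!%:R).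
  by rewrite -muntz_factor_mid //; field; rewrite !f0 two.
rewrite muntz_factor_1 sixteen /alpha !addn1 addn2.
have -> : (2 * n.+1 = (2 * n).+2)%N by lia.
have -> : n`!%:R = n%:R * n.-1`!%:R :> R by rewrite -natrM -[in n`!](prednK n0) factS
  prednK.
have -> : (2 * n)`!%:R = 2 * n%:R * (2 * n - 1)`!%:R :> R.
  have e : (2 * n = (2 * n - 1).+1)%N by lia.
  by rewrite [in LHS]e factS -e !natrM.
rewrite [(-1) ^+ n.+1]exprS.
have sg : (-1) ^+ n * (-1) ^+ n = 1 :> R by rewrite -expr2 sqrr_sign.
have nn0 : (n%:R : R) != 0 by rewrite pnatr_eq0 -lt0n.
transitivity (- ((-1) ^+ n * (-1) ^+ n) * ((4 * n%:R - 1) / 3 : R) * (4 * n)`!%:R / (2 *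
  16 ^+ n * (2 * n%:R * (2 * n - 1)`!%:R) * (2 * n).+1`!%:R)).
  by field; rewrite !f0 s0 nn0.
by rewrite sg; field; rewrite !f0 s0 nn0.
Qed.

End Constants.

(** * Inner products of w, qr and ql *)

Section W.
Variables (R : realType) (n : nat).
Hypothesis n_gt1 : (1 < n)%N.
Notation ip := (@L2dot R `[-1, 1]).
Notation N := (4 * n + 1)%N.
Notation m := (2 * n).+1.
Notation M1 := (2 * n - 1)%N.
Notation r0e := (@r0e R n).
Notation r0o := (@r0o R n).
Notation A1 := (muntz_factor R n M1).
Notation A2 := (muntz_factor R n 1).
Notation al := (@alpha R n).
Implicit Types f g h : R -> R.

Lemma odd_M1 : odd M1.
Proof. by rewrite oddB ?oddM //; lia. Qed.

(** The two indices M are 2 n - 1 and 1, both odd; hence [w] is even and its only powers that are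
    not polynomial are |t|^(2 n - 1) and |t|. *)
Lemma wE t : w n t = al * uM n M1 t + uM n 1 t.
Proof.
rewrite /w /u /uM; have -> : (N - 2 * (n + 1) = M1)%N by lia.
by have -> : (N - 4 * n = 1)%N by lia.
Qed.

Lemma w_even t : w n (- t) = w n t :> R.
Proof. by rewrite !wE !uM_even ?odd_M1. Qed.

Lemma cont_w : continuous (@w R n).
Proof.
have -> : @w R n = (fun t => al * uM n M1 t + uM n 1 t) by apply/funext => t; exact: wE.
by apply: contD; [apply: contZ; exact: cont_uM odd_M1|exact: cont_uM].
Qed.

Lemma w_1 : w n 1 = 0 :> R.
Proof. by rewrite wE !uM_1 ?odd_M1 // mulr0 addr0. Qed.

Lemma w_N1 : w n (-1) = 0 :> R.
Proof. by rewrite w_even w_1. Qed.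

Lemma w_orth (q : {poly R}) : bubble N q -> ip (@w R n) (horner q) = 0.
Proof.
move=> bq; have cq := @cont_horner R q.
transitivity (ip (horner q) (fun t => al * uM n M1 t + 1 * uM n 1 t)).
  by rewrite ipC; apply: eq_ip => // x _; rewrite wE mul1r.
rewrite (ip_lin _ _ cq (cont_uM odd_M1) (cont_uM _)) //.
by rewrite ![ip (horner q) _]ipC !uM_orth ?odd_M1 // !mulr0 addr0.
Qed.

Let K : R := (2 * n%:R + 1) * (4 * n%:R + 1).
Let K' : R := (2 * n%:R + 1) * (4 * n%:R + 3).
Let gam : R := al * A1 + A2.

(** The first remainder is orthogonal to the polynomial part of the second, because [muntz_factor]
    vanishes at the even nodes. Only |t|^M' is left, so the product is a single moment. *)
Lemma ip_remainders (M M' : nat) (q q' : {poly R}) : (size q' <= m)%N ->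
  (forall s, ip (nexp s) (fun t => evfun q t + nexp M t) =
    2 * muntz_factor R n M * muntz_factor R n s / (s%:R + M%:R + 1)) ->
  ip (fun t => evfun q t + nexp M t) (fun t => evfun q' t + nexp M' t) =
    2 * muntz_factor R n M * muntz_factor R n M' / (M'%:R + M%:R + 1).
Proof.
move=> sq' H; pose v t : R := evfun q t + nexp M t; rewrite -/v.
have cv : continuous v by apply: contD; [exact: cont_evfun|exact: cont_nexp].
rewrite (ipDr cv (@cont_evfun _ q') (@cont_nexp _ M')) (ip_evfun cv sq').
rewrite big1 ?add0r => [|k _]; first by rewrite ipC H.
by rewrite ipC H muntz_factor_even // mulr0 mul0r mulr0.
Qed.

Lemma ip_r0e_remainder (M : nat) (q : {poly R}) :
  (forall s, ip (nexp s) (fun t => evfun q t + nexp M t) =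
    2 * muntz_factor R n M * muntz_factor R n s / (s%:R + M%:R + 1)) ->
  ip r0e (fun t => evfun q t + nexp M t) = 0.
Proof.
move=> H; pose v t : R := evfun q t + nexp M t; rewrite -/v ipC.
have cv : continuous v by apply: contD; [exact: cont_evfun|exact: cont_nexp].
rewrite (ip_evfun cv (size_Pe _ _)) big1 // => k _.
by rewrite ipC H muntz_factor_even // mulr0 mul0r mulr0.
Qed.

(** Pythagoras for w = gam r0e - f, where [f] combines the two remainders and is orthogonal to
    [r0e]. The denominators 4 n - 1, 2 n + 1 and 3 are M + M' + 1 for M and M' among 2 n - 1 and
    1. *)
Lemma w_products :
  ip r0e (@w R n) = 2 / K * gam /\
  ip (@w R n) (@w R n) = 2 / K * gam ^+ 2 +
    2 * ((al * A1) ^+ 2 / (4 * n%:R - 1) + 2 * (al * A1) * A2 / (2 * n%:R + 1) + A2 ^+ 2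
      / 3).
Proof.
have [q1 [s1 u1 v1]] := muntz_remainder R n odd_M1.
have [q2 [s2 u2 v2]] := @muntz_remainder R n 1 isT.
pose f1 t : R := evfun q1 t + nexp M1 t; pose f2 t : R := evfun q2 t + nexp 1 t.
have cr := @cont_r0e R n.
have c1 : continuous f1 by apply: contD; [exact: cont_evfun|exact: cont_nexp].
have c2 : continuous f2 by apply: contD; [exact: cont_evfun|exact: cont_nexp].
pose f t := al * f1 t + 1 * f2 t.
have cf : continuous f by apply: contD; exact: contZ.
have wf t : w n t = gam * r0e t + (-1) * f t.
  by rewrite wE u1 u2 /gam /f /f1 /f2; ring.
have cw := cont_w.
have e1 : ip r0e f1 = 0 := ip_r0e_remainder v1.
have e2 : ip r0e f2 = 0 := ip_r0e_remainder v2.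
have ef : ip r0e f = 0 by rewrite (ip_lin _ _ cr c1 c2) e1 e2 !mulr0 addr0.
have ew : ip r0e (@w R n) = 2 / K * gam.
  transitivity (ip r0e (fun t => gam * r0e t + (-1) * f t)).
    by apply: eq_ip => // x _; exact: wf.
  by rewrite (ip_lin _ _ cr cr cf) ef ip_r0e_r0e -/K mulr0 addr0 mulrC.
split => //.
have fw : ip f (@w R n) = - ip f f.
  transitivity (ip f (fun t => gam * r0e t + (-1) * f t)).
    by apply: eq_ip => // x _; exact: wf.
  by rewrite (ip_lin _ _ cf cr cf) (ipC f r0e) ef; ring.
have ff : ip f f = al ^+ 2 * ip f1 f1 + 2 * al * ip f1 f2 + ip f2 f2.
  rewrite {2}/f (ip_lin _ _ cf c1 c2) !(ipC f) /f.
  by rewrite (ip_lin _ _ c1 c1 c2) (ip_lin _ _ c2 c1 c2) (ipC f2 f1); ring.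
have p11 : ip f1 f1 = 2 * A1 * A1 / (4 * n%:R - 1).
  rewrite (ip_remainders _ s1 v1); congr (_ / _).
  rewrite natrB; last lia. rewrite natrM; ring.
have p12 : ip f1 f2 = 2 * A1 * A2 / (2 * n%:R + 1).
  rewrite (ip_remainders _ s2 v1); congr (_ / _).
  rewrite natrB; last lia. rewrite natrM; ring.
have p22 : ip f2 f2 = 2 * A2 * A2 / 3.
  by rewrite (ip_remainders _ s2 v2); congr (_ / _); ring.
transitivity (ip (@w R n) (fun t => gam * r0e t + (-1) * f t)).
  by apply: eq_ip => // x _; exact: wf.
rewrite (ip_lin _ _ cw cr cf) !(ipC (@w R n)) ew fw ff p11 p12 p22.
have n1 : 2 <= n%:R :> R by rewrite ler_nat.
by field; apply/and3P; split; rewrite gt_eqF // /K; try apply: mulr_gt0; lra.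
Qed.

Let n2 : 2 <= n%:R :> R. Proof. by rewrite ler_nat. Qed.

Lemma muntz_factor_1_neq0 : A2 != 0.
Proof.
rewrite muntz_factor_1; have f0 k : (k`!%:R : R) != 0 by rewrite pnatr_eq0 -lt0n fact_gt0.
by rewrite mulf_neq0 // invr_neq0 // !mulf_neq0 // expf_neq0.
Qed.

Lemma gamE : gam = - (4 * (n%:R - 1) / 3) * A2.
Proof. by rewrite /gam alpha_muntz_factor; [field|lia]. Qed.

Lemma ip_r0e_w : ip r0e (@w R n) = - (8 * (n%:R - 1) / (3 * K)) * A2.
Proof.
rewrite w_products.1 gamE; field.
by rewrite gt_eqF // /K; apply: mulr_gt0; have := n2; lra.
Qed.

(** The factor (n - 1)^2 reflects the hypothesis on [n]: for n = 1 both indices M are 1 and the two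
    terms of [w] cancel. *)
Lemma ip_w_w : ip (@w R n) (@w R n) =
  A2 ^+ 2 * (16 * (n%:R - 1) ^+ 2 * (4 * n%:R + 3) / (9 * K)).
Proof.
rewrite w_products.2 gamE alpha_muntz_factor; last lia.
have := n2 => n2'; rewrite /K; field.
by apply/and3P; split; rewrite gt_eqF //; lra.
Qed.

Lemma ip_w_w_gt0 : 0 < ip (@w R n) (@w R n).
Proof.
rewrite ip_w_w; have := n2 => n2'; have a0 : 0 < A2 ^+ 2.
  by rewrite exprn_even_gt0 //= muntz_factor_1_neq0.
apply: mulr_gt0 => //; apply: divr_gt0; last by rewrite /K !mulr_gt0 //; lra.
by rewrite !mulr_gt0 ?exprn_gt0 //; lra.
Qed.

(** This is - <r0e, w> / <w, w>, as the closed forms show, so [qr] is [r0] minus its projection onto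
    [w]. *)
Definition qc : R := 3 * ((16 ^+ n * (2 * n)`!%:R * (2 * n + 1)`!%:R) /
       ((4 * n%:R + 3) * (n%:R - 1) * (4 * n)`!%:R)).

Lemma qcE : qc = 3 / (2 * (4 * n%:R + 3) * (n%:R - 1) * A2).
Proof.
rewrite /qc muntz_factor_1 addn1.
have f0 k : (k`!%:R : R) != 0 by rewrite pnatr_eq0 -lt0n fact_gt0.
have s0 : (16 : R) ^+ n != 0 by rewrite expf_neq0.
have := n2 => n2'; field.
by rewrite !f0 s0 /=; apply/andP; split; rewrite gt_eqF //; lra.
Qed.

Lemma qrE t : qr n t = r0e t + r0o t + qc * w n t.
Proof. by rewrite /qr r0E. Qed.

Lemma qlE t : ql n t = r0e t - r0o t + qc * w n t.
Proof. by rewrite /ql /qr r0NE w_even. Qed.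

Lemma cont_qr : continuous (@qr R n).
Proof. by apply: contD; [exact: cont_r0|apply: contZ; exact: cont_w]. Qed.

Lemma cont_ql : continuous (@ql R n).
Proof. exact: cont_opp cont_qr. Qed.

Lemma qr_orth (q : {poly R}) : bubble N q -> ip (@qr R n) (horner q) = 0.
Proof.
move=> bq; have cq := @cont_horner R q.
transitivity (ip (horner q) (fun t => 1 * r0 N t + qc * w n t)).
  by rewrite ipC; apply: eq_ip => // x _; rewrite mul1r.
rewrite (ip_lin _ _ cq (@cont_r0 _ _) cont_w) ![ip (horner q) _]ipC.
by rewrite r0_orth // w_orth // !mulr0 addr0.
Qed.

Lemma ql_orth (q : {poly R}) : bubble N q -> ip (@ql R n) (horner q) = 0.
Proof.
move=> bq; rewrite -(qr_orth (bubble_compN bq)) -[RHS]ipN;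
  [|exact: cont_qr|exact: cont_horner].
by apply: eq_ip => // x _; rewrite horner_comp hornerN hornerX opprK.
Qed.

Lemma ip_r0o_w : ip r0o (@w R n) = 0.
Proof. by apply: ip_odd_even; [exact: cont_r0o|exact: cont_w|exact: r0oN|exact: w_even].
  Qed.

Lemma ip_comb (a : R) f : continuous f ->
  ip f (fun t => r0e t + a * r0o t + qc * w n t) =
  ip f r0e + a * ip f r0o + qc * ip f (@w R n).
Proof.
move=> cf; have c1 := @cont_r0e R n; have c2 := @cont_r0o R n; have c3 := cont_w.
transitivity (ip f (fun t => 1 * (1 * r0e t + a * r0o t) + qc * w n t)).
  by apply: eq_ip => // x _; rewrite !mul1r.
have c12 : continuous (fun t => 1 * r0e t + a * r0o t) by apply: contD; exact: contZ.
by rewrite (ip_lin _ _ cf c12 c3) (ip_lin _ _ cf c1 c2) !mul1r.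
Qed.

(** The signs 1 and -1 for [a] and [b] give [qr] and [ql]. Cross terms between the odd [r0o] and the
    even [r0e], [w] vanish, so the signs survive only in the product a b. *)
Lemma ip_combs (a b : R) :
  ip (fun t => r0e t + a * r0o t + qc * w n t) (fun t => r0e t + b * r0o t + qc * w n t) =
  2 / K + a * b * (2 / K') + 2 * qc * ip r0e (@w R n) + qc ^+ 2 * ip (@w R n) (@w R n).
Proof.
have c1 := @cont_r0e R n; have c2 := @cont_r0o R n; have c3 := cont_w.
pose f t := r0e t + a * r0o t + qc * w n t; rewrite -/f.
have c : continuous f by do 2![apply: contD => //; last exact: contZ].
rewrite (ip_comb b c) (ipC f r0e) (ipC f r0o) (ipC f (@w R n)).
rewrite (ip_comb a c1) (ip_comb a c2) (ip_comb a c3).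
rewrite (ipC r0o r0e) (ipC (@w R n) r0e) (ipC (@w R n) r0o).
rewrite ip_r0e_r0o ip_r0o_w ip_r0e_r0e ip_r0o_r0o -/K -/K'; ring.
Qed.

Lemma ip_w_comb (a : R) : ip (@w R n) (fun t => r0e t + a * r0o t + qc * w n t) = 0.
Proof.
rewrite ip_comb; last exact: cont_w.
rewrite !(ipC (@w R n) r0e) !(ipC (@w R n) r0o) ip_r0o_w ip_r0e_w ip_w_w qcE.
have := n2 => n2'; rewrite /K; field; rewrite muntz_factor_1_neq0 /=.
by apply/and4P; split; rewrite gt_eqF //; lra.
Qed.

Lemma qr_comb t : qr n t = r0e t + 1 * r0o t + qc * w n t.
Proof. by rewrite mul1r qrE. Qed.

Lemma ql_comb t : ql n t = r0e t + (-1) * r0o t + qc * w n t.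
Proof. by rewrite mulN1r qlE. Qed.

Lemma ip_w_qr : ip (@w R n) (@qr R n) = 0.
Proof. by rewrite -(ip_w_comb 1); apply: eq_ip => // x _; exact: qr_comb. Qed.

Lemma ip_w_ql : ip (@w R n) (@ql R n) = 0.
Proof. by rewrite -(ip_w_comb (-1)); apply: eq_ip => // x _; exact: ql_comb. Qed.

(** Projecting off [w] lowers <r0e, r0e> = 2 / K by 4 / (K (4 n + 3)), which is exactly the gap to
    <r0o, r0o> = 2 / K'. *)
Lemma ip_qr_ql : ip (@qr R n) (@ql R n) = 0.
Proof.
transitivity (ip (fun t => r0e t + 1 * r0o t + qc * w n t) (fun t => r0e t + (-1) * r0o t
  + qc * w n t)).
  by apply: eq_ip => x _; [exact: qr_comb|exact: ql_comb].
rewrite ip_combs ip_r0e_w ip_w_w qcE.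
have := n2 => n2'; rewrite /K /K'; field; rewrite muntz_factor_1_neq0 /=.
by apply/and4P; split; rewrite gt_eqF //; lra.
Qed.

Lemma ip_qr_qr_gt0 : 0 < ip (@qr R n) (@qr R n).
Proof.
(* The even and odd parts of [qr] each have squared norm 2 / K'. *)
have -> : ip (@qr R n) (@qr R n) = 4 / K'.
  rewrite (_ : ip _ _ = ip (fun t => r0e t + 1 * r0o t + qc * w n t) (fun t => r0e t + 1
    * r0o t + qc * w n t)).
    rewrite ip_combs ip_r0e_w ip_w_w qcE.
    have := n2 => n2'; rewrite /K /K'; field; rewrite muntz_factor_1_neq0 /=.
    by apply/and4P; split; rewrite gt_eqF //; lra.
  by apply: eq_ip => x _; exact: qr_comb.
by have := n2 => n2'; rewrite divr_gt0 // /K' mulr_gt0 //; lra.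
Qed.

Lemma ip_ql_ql : ip (@ql R n) (@ql R n) = ip (@qr R n) (@qr R n).
Proof. by apply: ipN; exact: cont_qr. Qed.

Lemma qr_1 : qr n 1 = 2 :> R.
Proof. by rewrite /qr r0_1 w_1 mulr0 addr0. Qed.

Lemma qr_N1 : qr n (-1) = 0 :> R.
Proof. by rewrite /qr r0_N1 w_N1 mulr0 addr0. Qed.

End W.

(** * Cells of the real line *)

Section Affine.
Variable R : realType.
Notation mu := (@lebesgue_measure R).
Variables (a b : R).
Hypothesis a_gt0 : 0 < a.

Let phi (x : R) : R := a * x + b.

Lemma cont_affine : continuous phi.
Proof.
by apply: contD; [apply: contZ => x; exact: cvg_id|exact: cont_cst].
Qed.

Let mphi : measurable_fun setT (phi : measurableTypeR R -> measurableTypeR R).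
Proof. exact: continuous_measurable_fun cont_affine. Qed.

Let nu : {measure set (measurableTypeR R) -> \bar R} :=
  measure_function_pushforward__canonical__measure_function_Measure mu mphi.

(** Lebesgue measure is characterized by its values on half-open intervals, and [a] times the image
    measure under [phi] has the same ones. *)
Lemma lebesgue_measure_affine (A : set R) : measurable A ->
  mu A = mscale (NngNum (ltW a_gt0)) nu A.
Proof.
move=> mA; apply: lebesgue_measure_unique => //= _ [[x y]] _ <- /=.
rewrite /mscale /= /pushforward /=.
have -> : phi @^-1` `]x, y]%classic = `](x - b) / a, (y - b) / a]%classic.
  apply/seteqP; split => t /=; rewrite !in_itv /= ltr_pdivrMr // ler_pdivlMr // ltrBlDr
    lerBrDr.
    by rewrite mulrC.
  by rewrite mulrC.
rewrite !lebesgue_measure_itv /= !lte_fin ltr_pM2r ?invr_gt0 // ltrD2r.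
case: ifP => _; last by rewrite mule0.
by rewrite -!EFinB -EFinM; congr EFin; field; rewrite gt_eqF.
Qed.

Lemma ge0_integral_affine (f : R -> \bar R) : measurable_fun setT f ->
  (forall x, (0 <= f x)%E) ->
  (\int[mu]_x f x = a%:E * \int[mu]_x f (phi x))%E.
Proof.
move=> mf f0.
rewrite (@eq_measure_integral _ _ _ _ (mscale (NngNum (ltW a_gt0)) nu)); last first.
  by move=> A mA _; exact: lebesgue_measure_affine.
rewrite ge0_integral_mscale //=; congr (_ * _)%E.
by rewrite ge0_integral_pushforward //= preimage_setT.
Qed.

Lemma Rintegral_affine (f : R -> R) : mu.-integrable setT (EFin \o f) ->
  mu.-integrable setT (EFin \o (f \o phi)) ->
  \int[mu]_x f x = a * \int[mu]_x f (phi x).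
Proof.
move=> intf intg; have mf := measurable_int _ intf.
rewrite /Rintegral integralE [X in _ = a * fine X]integralE.
have fp h : mu.-integrable setT (EFin \o h) ->
    (\int[mu]_x ((EFin \o h)^\+ x) \is a fin_num)%E /\
    (\int[mu]_x ((EFin \o h)^\- x) \is a fin_num)%E.
  by move=> ih; split; [exact: integrable_pos_fin_num|exact: integrable_neg_fin_num].
have [f1 f2] := fp _ intf; have [g1 g2] := fp _ intg.
rewrite -[EFin \o (f \o phi)]/((EFin \o f) \o phi) funepos_comp funeneg_comp in g1 g2 *.
rewrite (fineB f1 f2) (fineB g1 g2) mulrBr; congr (_ - _).
  rewrite ge0_integral_affine //; last exact: measurable_funepos.
  exact: (@fineM _ a%:E _ isT g1).
rewrite ge0_integral_affine //; last exact: measurable_funeneg.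
exact: (@fineM _ a%:E _ isT g2).
Qed.

End Affine.

Section L2.
Variable R : realType.
Notation mu := (@lebesgue_measure R).

Lemma Lnorm2_sqr (f : R -> R) :
  (('N[mu]_2%:E[EFin \o f]) `^ 2 = \int[mu]_x (f x ^+ 2)%:E)%E.
Proof.
rewrite poweR_Lnorm ?pnatr_eq0 //; apply: eq_integral => x _ /=.
by rewrite powR_mulrn // real_normK ?num_real.
Qed.

Lemma L2norm_sqr (f : R -> R) : L2norm f ^+ 2 = \int[mu]_x (f x ^+ 2).
Proof.
rewrite /L2norm /Rintegral -Lnorm2_sqr.
have := Lnorm_ge0 mu 2%:E (EFin \o f).
case: (Lnorm _ _ _) => [r| |] //=.
  by rewrite lee_fin => r0; rewrite powR_mulrn.
(* Infinite norm: [fine] sends both sides to 0. *)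
by move=> _; rewrite pnatr_eq0 expr0n.
Qed.

Lemma L2norm_ge0 (f : R -> R) : 0 <= L2norm f.
Proof. by apply: fine_ge0; exact: Lnorm_ge0. Qed.

Lemma L2P (f : R -> R) : L2 f <->
  measurable_fun setT f /\ (\int[mu]_x (f x ^+ 2)%:E < +oo)%E.
Proof.
rewrite -Lnorm2_sqr /L2 inE; split.
  move=> /andP[/set_mem mf /set_mem /=]; rewrite /finite_norm => fin; split => //.
  by rewrite poweR_lty.
move=> [mf h]; apply/andP; split; apply/mem_set => //=.
rewrite /finite_norm; have := Lnorm_ge0 mu 2%:E (EFin \o f).
move: h; case: (Lnorm _ _ _) => [r _ _||] //; first by rewrite ltry.
by rewrite poweRyr ?pnatr_eq0.
Qed.

End L2.

Section Cells.
Variable R : realType.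
Notation mu := (@lebesgue_measure R).
Notation ip := (@L2dot R `[-1, 1]).
Implicit Types f g : R -> R.

(** Half-open cells are disjoint everywhere and not just almost everywhere, so products over
    distinct cells vanish pointwise. *)
Definition cell f (k : int) (t : R) : R :=
  if k%:~R <= t < k%:~R + 1 then f (2 * (t - k%:~R) - 1) else 0.

Lemma cell_shift f (k l : int) t : cell f k (t - l%:~R) = cell f (k + l) t.
Proof.
rewrite /cell rmorphD /= lerBrDr ltrBlDr addrAC; congr (if _ then f _ else _); ring.
Qed.

Lemma cell_inj (k l : int) (t : R) :
  k%:~R <= t < k%:~R + 1 -> l%:~R <= t < l%:~R + 1 -> k = l.
Proof.
move=> /andP[k1 k2] /andP[l1 l2].
have : (k%:~R : R) < (l + 1)%:~R by rewrite rmorphD /=; lra.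
have : (l%:~R : R) < (k + 1)%:~R by rewrite rmorphD /=; lra.
rewrite !ltr_int; lia.
Qed.

Lemma cell_mul f g k t : cell f k t * cell g k t = cell (fun x => f x * g x) k t.
Proof. by rewrite /cell; case: ifP; rewrite ?mulr0. Qed.

Lemma cell_mul0 f g k l t : k != l -> cell f k t * cell g l t = 0.
Proof.
rewrite /cell; case: ifP => [hk|_]; last by rewrite mul0r.
case: ifP => [hl|_]; last by rewrite mulr0.
by rewrite (cell_inj hk hl) eqxx.
Qed.

(** Cutting off before rescaling makes every cell an affine pullback of one function on the whole
    line; slope 2 then yields the factor 1/2 in the integrals. *)
Definition window f : R -> R := f \_ `[-1, 1[%classic.

Lemma cellE f k : cell f k = window f \o (fun t => 2 * t + (- 2 * k%:~R - 1)).
Proof.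
apply/funext => t; rewrite /cell /window /= patchE.
have -> : (2 * t + (- 2 * k%:~R - 1) \in `[-1, 1[%classic) = (k%:~R <= t < k%:~R + 1).
  apply/idP/idP; first by rewrite inE /= in_itv /= => /andP[? ?]; apply/andP; split; lra.
  by move=> /andP[? ?]; rewrite inE /= in_itv /=; apply/andP; split; lra.
by case: ifP => // _; congr f; ring.
Qed.

Lemma integrable_window f : continuous f -> mu.-integrable setT (EFin \o window f).
Proof.
move=> cf; rewrite /window -restrict_EFin; apply/integrable_restrict => //.
rewrite setTI; apply: integrableS (continuous_integrable (-1) 1 cf) => //.
by apply: subset_itvl; rewrite bnd_simp.
Qed.

Lemma Rintegral_window f : continuous f -> \int[mu]_x window f x = itg f.
Proof.
move=> cf; rewrite /window -Rintegral_mkcond /itg -Rintegral_itv_bndo_bndc //.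
apply: integrableS (continuous_integrable (-1) 1 cf) => //.
by apply: subset_itvl; rewrite bnd_simp.
Qed.

Lemma integrable_cell f k : continuous f -> mu.-integrable setT (EFin \o cell f k).
Proof.
move=> cf; pose h t := f (2 * t + (- 2 * k%:~R - 1)).
have ch : continuous h.
  move=> t; apply: (@continuous_comp _ _ _ (fun t : R => 2 * t + (- 2 * k%:~R - 1)) f).
    exact: (@cont_affine R 2 _).
  exact: cf.
have -> : cell f k = h \_ `[k%:~R, k%:~R + 1[%classic.
  apply/funext => t; rewrite /cell patchE mem_setE in_itv /=.
  by case: ifP => // _; rewrite /h; congr f; ring.
rewrite -restrict_EFin; apply/integrable_restrict => //.
rewrite setTI; apply: integrableS (continuous_integrable k%:~R (k%:~R + 1) ch) => //.
by apply: subset_itvl; rewrite bnd_simp.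
Qed.

Lemma Rintegral_cell f k : continuous f -> \int[mu]_x cell f k x = 2^-1 * itg f.
Proof.
move=> cf; have two : (0 : R) < 2 by lra.
have ic := integrable_cell k cf; rewrite cellE in ic.
rewrite -(Rintegral_window cf) (Rintegral_affine two (integrable_window cf) ic).
by rewrite mulrA mulVf ?pnatr_eq0 // mul1r cellE.
Qed.

End Cells.

(** * Gram matrices and finite orthogonal sums *)

Section Gram.
Variable R : realType.
Notation mu := (@lebesgue_measure R).
Notation ip := (@L2dot R `[-1, 1]).
Implicit Types f g : R -> R.

Lemma integrable_cell_mul f g k l : continuous f -> continuous g ->
  mu.-integrable setT (EFin \o (fun t => cell f k t * cell g l t)).
Proof.
move=> cf cg; have [->|kl] := eqVneq k l.
  have -> : (fun t => cell f l t * cell g l t) = cell (fun x => f x * g x) l.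
    by apply/funext => t; exact: cell_mul.
  exact: integrable_cell (contM cf cg).
have -> : (fun t => cell f k t * cell g l t) = cst 0.
  by apply/funext => t; exact: cell_mul0.
exact: integrable0.
Qed.

Lemma L2dot_cell f g k l : continuous f -> continuous g ->
  L2dot setT (cell f k) (cell g l) = if k == l then 2^-1 * ip f g else 0.
Proof.
move=> cf cg; rewrite /L2dot; have [->|kl] := eqVneq k l.
  rewrite -(Rintegral_cell l (contM cf cg)); congr (\int[_]_(x in _) _).
  by apply/funext => t; exact: cell_mul.
rewrite -[RHS](mul0r (fine (mu setT))) -Rintegral_cst //.
by congr (\int[_]_(x in _) _); apply/funext => t; exact: cell_mul0.
Qed.

Section Sums.
Variables (I : eqType) (h : I -> R -> R).
Hypothesis ih : forall i, mu.-integrable setT (EFin \o h i).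

Lemma integrable_lincomb (s : seq I) (c : I -> R) :
  mu.-integrable setT (EFin \o (fun t => \sum_(i <- s) c i * h i t)).
Proof.
elim: s => [|i s IH].
  rewrite (_ : _ \o _ = cst 0%E); first exact: integrable0.
  by apply/funext => t; rewrite /= big_nil.
pose S t := \sum_(j <- s) c j * h j t.
have -> : EFin \o (fun t => \sum_(j <- i :: s) c j * h j t) =
    ((fun t : R => ((c i)%:E * (EFin \o h i) t)%E) \+ (EFin \o S))%E.
  by apply/funext => t; rewrite /= big_cons.
by apply: integrableD => //; apply: integrableZl => //; exact: ih.
Qed.

Lemma Rintegral_lincomb (s : seq I) (c : I -> R) :
  \int[mu]_t (\sum_(i <- s) c i * h i t) = \sum_(i <- s) c i * \int[mu]_t h i t.
Proof.
elim: s => [|i s IH].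
  rewrite big_nil -[RHS](mul0r (fine (mu setT))) -Rintegral_cst //.
  by congr (\int[_]_(x in _) _); apply/funext => t; rewrite big_nil.
rewrite big_cons -IH -(RintegralZl (c i) measurableT (ih i)).
rewrite -RintegralD //; [|exact: integrableZl (ih i)|exact: integrable_lincomb].
by congr (\int[_]_(x in _) _); apply/funext => t; rewrite big_cons.
Qed.

End Sums.

Section Orthogonal.
Variables (I : eqType) (e : I -> R -> R) (nrm : I -> R).
Hypothesis ie : forall i j, mu.-integrable setT (EFin \o (fun t => e i t * e j t)).
Hypothesis gram : forall i j, L2dot setT (e i) (e j) = if i == j then nrm i else 0.

Lemma L2norm_lincomb_sqr (s : seq I) (c : I -> R) : uniq s ->
  L2norm (lincomb e s c) ^+ 2 = \sum_(i <- s) c i ^+ 2 * nrm i.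
Proof.
move=> us; rewrite L2norm_sqr /lincomb.
have iei i := fun j => ie i j.
transitivity (\int[mu]_t (\sum_(i <- s) c i * (\sum_(j <- s) c j * (e i t * e j t)))).
  congr (\int[_]_(x in _) _); apply/funext => t.
  rewrite expr2 mulr_suml; apply: eq_bigr => i _.
  by rewrite -mulrA mulr_sumr; congr (_ * _); apply: eq_bigr => j _; ring.
rewrite (@Rintegral_lincomb _ (fun i t => \sum_(j <- s) c j * (e i t * e j t))); last first.
  by move=> i; exact: (integrable_lincomb (iei i)).
rewrite [RHS]big_seq [LHS]big_seq; apply: eq_bigr => i si.
rewrite (Rintegral_lincomb (iei i)) (bigD1_seq i) //= big1 ?addr0.
  by have := gram i i; rewrite eqxx /L2dot => ->; ring.
move=> j ij; have := gram i j; rewrite eq_sym (negbTE ij) /L2dot => ->.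
by rewrite mulr0.
Qed.

End Orthogonal.

End Gram.

(** * Orthogonality of the translates of the generators *)

Section Generators.
Variables (R : realType) (n : nat).
Hypothesis n_gt1 : (1 < n)%N.
Notation mu := (@lebesgue_measure R).
Notation ip := (@L2dot R `[-1, 1]).
Notation N := (4 * n + 1)%N.
Notation T := (translates (@tphi R n)).
Implicit Types (i j : 'I_N.+1) (a b : 'I_N.+1 * int).

(* The generators on the two unit cells of their support, rescaled to [-1, 1]. *)
Definition lpart (i : nat) : R -> R := if i is 0 then @qr R n else cst 0.
Definition rpart (i : nat) : R -> R :=
  match i with 0 => @ql R n | 1 => @w R n | _ => horner (phi0_poly R i) end.

Lemma cont_lpart i : continuous (lpart i).
Proof. by case: i => -[|i] Hi; [exact: cont_qr|exact: cont_cst]. Qed.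

Lemma cont_rpart i : continuous (rpart i).
Proof. by case: i => -[|[|i]] Hi; [exact: cont_ql|exact: cont_w|exact: cont_horner]. Qed.

Lemma tphiE i t : tphi i t = cell (lpart i) (-1) t + cell (rpart i) 0 t.
Proof.
have c0 f x : cell f 0 x = if 0 <= x < 1 then f (2 * x - 1) else 0 :> R.
  by rewrite /cell add0r subr0.
have lcst k x : cell (cst 0) k x = 0 :> R by rewrite /cell; case: ifP.
case: i => -[|[|i]] Hi; rewrite /tphi /= c0 ?lcst ?add0r //.
  have -> : cell (@qr R n) (-1) t = if -1 <= t < 0 then qr n (2 * t + 1) else 0.
    rewrite /cell rmorphN /= addNr; case: ifP => // _; congr (qr _ _); ring.
  case: ifP => [/andP[t1 t0]|_]; last by rewrite add0r.
  by rewrite ifF ?addr0 //; apply/negbTE; rewrite negb_and -ltNge t0.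
by case: ifP => // _; rewrite phi0E.
Qed.

Lemma translatesE a t :
  T a t = cell (lpart a.1) (a.2 - 1) t + cell (rpart a.1) a.2 t.
Proof. by rewrite /translates tphiE !cell_shift add0r (addrC (-1)). Qed.

Lemma ip0l f : continuous f -> ip (cst 0) f = 0.
Proof.
move=> cf; rewrite ipC -[RHS](mul0r (ip f f)) -ipZr //.
by apply: eq_ip => // x _; rewrite mul0r.
Qed.

Lemma rpart_bubble j : (1 < j)%N -> bubble N (phi0_poly R j).
Proof. by move=> j2; apply: phi0_bubble; [lia|rewrite j2 -ltnS /=]. Qed.

(** This is the overlap of consecutive translates, which share one cell. The case <qr, ql> is the
    one that dictates [alpha]; in the others [qr] meets [w] or a bubble, or the left part is
    zero. *)
Lemma ip_lpart_rpart i j : ip (lpart i) (rpart j) = 0.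
Proof.
have cr := @cont_rpart j.
case: i => -[|i] Hi /=; last exact: ip0l.
case: j cr => -[|[|j]] Hj /= cr.
- exact: ip_qr_ql.
- by rewrite ipC; exact: ip_w_qr.
- by apply: qr_orth => //; exact: (@rpart_bubble (Ordinal Hj)).
Qed.

Lemma ip_lpart_neq i j : i != j -> ip (lpart i) (lpart j) = 0.
Proof.
have cl := cont_lpart; case: i => -[|i] Hi; last by move=> _; exact: ip0l.
case: j => -[|j] Hj; last by move=> _; rewrite ipC; apply: ip0l; exact: cont_qr.
by rewrite -val_eqE.
Qed.

Lemma ip_rpart_neq i j : i != j -> ip (rpart i) (rpart j) = 0.
Proof.
rewrite -val_eqE.
case: i => -[|[|i]] Hi; case: j => -[|[|j]] Hj //= ij.
- by rewrite ipC ip_w_ql.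
- by apply: ql_orth => //; exact: (@rpart_bubble (Ordinal Hj)).
- exact: ip_w_ql.
- by apply: w_orth => //; exact: (@rpart_bubble (Ordinal Hj)).
- by rewrite ipC; apply: ql_orth => //; exact: (@rpart_bubble (Ordinal Hi)).
- by rewrite ipC; apply: w_orth => //; exact: (@rpart_bubble (Ordinal Hi)).
- exact: ip_phi0_neq.
Qed.

Definition gram_norm i : R := 2^-1 * (ip (lpart i) (lpart i) + ip (rpart i) (rpart i)).

Lemma ip_ge0 f : 0 <= ip f f.
Proof. by apply: itg_ge0 => x _; rewrite -expr2 sqr_ge0. Qed.

Lemma gram_norm_gt0 i : 0 < gram_norm i.
Proof.
rewrite mulr_gt0 ?invr_gt0 //; apply: ltr_wpDl; first exact: ip_ge0.
case: i => -[|[|i]] Hi /=.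
- by rewrite ip_ql_ql // ip_qr_qr_gt0.
- exact: ip_w_w_gt0.
- rewrite lt_def ip_ge0 andbT; apply/eqP => /ip_poly_eq0 /eqP.
  by rewrite (negbTE (phi0_poly_neq0 _ _)).
Qed.

Lemma integrable_translates_mul a b :
  mu.-integrable setT (EFin \o (fun t => T a t * T b t)).
Proof.
(* The booleans select the left or right part of each factor, turning the product into a sum of four
   cell products. *)
pose h (p : bool * bool) t := 
  cell (if p.1 then lpart a.1 else rpart a.1) (if p.1 then a.2 - 1 else a.2) t *
  cell (if p.2 then lpart b.1 else rpart b.1) (if p.2 then b.2 - 1 else b.2) t.
have ih p : mu.-integrable setT (EFin \o h p).
  by apply: integrable_cell_mul; case: ifP => _;
    [exact: cont_lpart|exact: cont_rpart|exact: cont_lpart|exact: cont_rpart].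
have := integrable_lincomb ih [:: (true, true); (true, false); (false, true);
  (false, false)] (fun _ => 1).
rewrite (_ : (fun t => \sum_(i <- _) _) = (fun t => T a t * T b t)) //.
apply/funext => t; rewrite !big_cons big_nil /h /= !translatesE; ring.
Qed.

Lemma gram_translates a b :
  L2dot setT (T a) (T b) = if a == b then gram_norm a.1 else 0.
Proof.
pose la := cell (lpart a.1) (a.2 - 1); pose ra := cell (rpart a.1) a.2.
pose lb := cell (lpart b.1) (b.2 - 1); pose rb := cell (rpart b.1) b.2.
pose h (p : bool * bool) t := (if p.1 then la else ra) t * (if p.2 then lb else rb) t.
have [cla cra clb crb] : [/\ continuous (lpart a.1), continuous (rpart a.1),
    continuous (lpart b.1) & continuous (rpart b.1)].
  by split; [exact: cont_lpart|exact: cont_rpart|exact: cont_lpart|exact: cont_rpart].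
have ih p : mu.-integrable setT (EFin \o h p).
  by case: p => -[] []; apply: integrable_cell_mul.
have -> : L2dot setT (T a) (T b) =
    L2dot setT la lb + L2dot setT la rb + L2dot setT ra lb + L2dot setT ra rb.
  transitivity (\int[mu]_t (\sum_(p <- [:: (true, true); (true, false); (false, true);
    (false, false)]) 1 * h p t)).
    congr (\int[_]_(x in _) _); apply/funext => t.
    rewrite !big_cons big_nil /h /= !translatesE -/la -/lb -/ra -/rb; ring.
  by rewrite (Rintegral_lincomb ih) !big_cons big_nil /h /= !mul1r addr0 !addrA.
(* Mixed products vanish whatever the shifts; left parts meet left parts, and right parts meet right
   parts, only when the shifts agree. *)
rewrite !L2dot_cell // ip_lpart_rpart (ipC (rpart _)) ip_lpart_rpart !mulr0 !if_same !addr0.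
have -> : (a.2 - 1 == b.2 - 1) = (a.2 == b.2) by rewrite (inj_eq (addIr _)).
case: a b {la ra lb rb h ih cla cra clb crb} => [i k] [j l] /=; rewrite xpair_eqE.
case: (eqVneq k l) => _; last by rewrite andbF addr0.
rewrite andbT; case: (eqVneq i j) => [->|ij]; first by rewrite /gram_norm mulrDr.
by rewrite ip_lpart_neq // ip_rpart_neq // !mulr0 addr0.
Qed.

Lemma measurable_translates a : measurable_fun setT (T a).
Proof.
have -> : T a = (fun t => cell (lpart a.1) (a.2 - 1) t + cell (rpart a.1) a.2 t).
  by apply/funext => t; exact: translatesE.
apply: measurable_funD; apply/measurable_EFinP; apply: (measurable_int mu);
  apply: integrable_cell.
  exact: cont_lpart.
exact: cont_rpart.
Qed.

Lemma L2_translates a : L2 (T a).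
Proof.
apply/L2P; split; first exact: measurable_translates.
have /integrableP[_] := integrable_translates_mul a a.
congr (_ < _)%E; apply: eq_integral => x _.
by rewrite /= expr2 ger0_norm // -expr2 sqr_ge0.
Qed.

End Generators.

(** * Refinability *)

Section Span.
Variables (R : realType) (I : eqType) (e : I -> R -> R).

Definition fspan (h : R -> R) : Prop := exists s c, h = lincomb e s c.

(** In [lincomb] a repeated index carries a single coefficient, so coefficients are merged over the
    distinct indices. With lists of pairs, sums become concatenations. *)
Lemma fspan_pairs (l : seq (I * R)) : fspan (fun t => \sum_(p <- l) p.2 * e p.1 t).
Proof.
pose s := undup [seq p.1 | p <- l].
exists s, (fun i => \sum_(p <- l | p.1 == i) p.2).
apply/funext => t; rewrite /lincomb.
transitivity (\sum_(i <- s) \sum_(p <- l) if p.1 == i then p.2 * e p.1 t else 0).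
  rewrite exchange_big /= [LHS]big_seq [RHS]big_seq; apply: eq_bigr => p pl.
  rewrite (bigD1_seq p.1) /= ?undup_uniq //; last by rewrite mem_undup map_f.
  by rewrite eqxx big1 ?addr0 // => i /negbTE; rewrite eq_sym => ->.
apply: eq_bigr => i _; rewrite -big_mkcond mulr_suml /=.
by apply: eq_bigr => p /eqP ->.
Qed.

Lemma fspanE h : fspan h <-> exists l : seq (I * R), h = (fun t => \sum_(p <- l) p.2 * e
  p.1 t).
Proof.
split=> [[s [c ->]]|[l ->]]; last exact: fspan_pairs.
by exists [seq (i, c i) | i <- s]; apply/funext => t; rewrite big_map.
Qed.

Lemma fspan_e i : fspan (e i).
Proof. by apply/fspanE; exists [:: (i, 1)]; apply/funext => t; rewrite big_seq1 mul1r. Qed.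

Lemma fspanD h h' : fspan h -> fspan h' -> fspan (fun t => h t + h' t).
Proof.
move=> /fspanE[l ->] /fspanE[l' ->]; apply/fspanE; exists (l ++ l').
by apply/funext => t; rewrite big_cat.
Qed.

Lemma fspanZ a h : fspan h -> fspan (fun t => a * h t).
Proof.
move=> /fspanE[l ->]; apply/fspanE; exists [seq (p.1, a * p.2) | p <- l].
apply/funext => t; rewrite big_map mulr_sumr.
by apply: eq_bigr => p _; rewrite mulrA.
Qed.

Lemma fspan_sum (J : Type) (r : seq J) (h : J -> R -> R) :
  (forall j, fspan (h j)) -> fspan (fun t => \sum_(j <- r) h j t).
Proof.
move=> fh; elim: r => [|j r IH].
  by apply/fspanE; exists [::]; apply/funext => t; rewrite !big_nil.
have := fspanD (fh j) IH; congr fspan.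
by apply/funext => t; rewrite big_cons.
Qed.

End Span.

Section Refinement.
Variables (R : realType) (n : nat).
Hypothesis n_gt1 : (1 < n)%N.
Notation N := (4 * n + 1)%N.
Notation T := (translates (@tphi R n)).
Notation S := (fspan T).

Lemma fspan_cell_phi0 j (k : int) : (2 <= j < N.+1)%N -> S (cell (horner (phi0_poly R j))
  k).
Proof.
move=> /andP[j2 jN]; have := fspan_e T (Ordinal jN, k); congr fspan.
apply/funext => t; rewrite translatesE /=.
case: j j2 jN => [|[|j]] // _ _ /=.
by rewrite [X in X + _](_ : _ = 0) ?add0r // /cell; case: ifP.
Qed.

Lemma fspan_cell_w (k : int) : S (cell (@w R n) k).
Proof.
have h1 : (1 < N.+1)%N by lia.
have := fspan_e T (Ordinal h1, k); congr fspan.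
apply/funext => t; rewrite translatesE /=.
by rewrite [X in X + _](_ : _ = 0) ?add0r // /cell; case: ifP.
Qed.

Lemma fspan_cell_bubble (p : {poly R}) (k : int) : bubble N p -> S (cell (horner p) k).
Proof.
move=> /phi0_span[c pE].
(* [fspan_sum] asks for membership at every [j]; outside the range the index defaults to 2 with
   coefficient 0. *)
have H : S (fun t => \sum_(j <- index_iota 2 N.+1) (if (2 <= j < N.+1)%N then c j else 0) *
    cell (horner (phi0_poly R (if (2 <= j < N.+1)%N then j else 2))) k t).
  apply: fspan_sum => j; apply: fspanZ; apply: fspan_cell_phi0.
  by case: ifP => // _; lia.
move: H; congr fspan; apply/funext => t; rewrite /cell; case: ifP => _.
  rewrite pE horner_sum big_nat [RHS]big_nat; apply: eq_bigr => j ->.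
  by rewrite hornerZ.
by rewrite big1 // => j _; rewrite mulr0.
Qed.

(** Twice the piecewise linear hat function at [k]. Hats and cell bubbles together produce the
    continuous piecewise polynomials with integer knots. *)
Definition hat (k : int) (t : R) : R :=
  cell (fun s => 1 + s) (k - 1) t + cell (fun s => 1 - s) k t.

Lemma cellD f g k t : cell (fun s : R => f s + g s) k t = cell f k t + cell g k t.
Proof. by rewrite /cell; case: ifP; rewrite ?addr0. Qed.

Lemma cellZ a f k t : cell (fun s : R => a * f s) k t = a * cell f k t.
Proof. by rewrite /cell; case: ifP; rewrite ?mulr0. Qed.

Lemma eq_cell f g k t : (forall s : R, -1 <= s < 1 -> f s = g s) -> cell f k t = cell g k t.
Proof.
by move=> fg; rewrite /cell; case: ifP => // /andP[t1 t2]; apply: fg; apply/andP; split;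
  lra.
Qed.

Lemma fspan_hat k : S (hat k).
Proof.
have h0 : (0 < N.+1)%N by [].
have cx : continuous (fun t : R => 1 + t) := @cont_1x R.
have [bp _] := is_bubble_proj_bubble_proj (N_gt0 n) cx.
set p := bubble_proj N _ in bp.
have := fspanD (fspanD (fspanD (fspan_e T (Ordinal h0, k)) (fspan_cell_bubble (k - 1) bp))
  (fspan_cell_bubble k (bubble_compN bp)))
  (fspanD (fspanZ (- qc R n) (fspan_cell_w (k - 1))) (fspanZ (- qc R n) (fspan_cell_w k))).
congr fspan; apply/funext => t; rewrite translatesE /= /hat.
have -> : cell (fun s => 1 + s) (k - 1) t = cell (@qr R n) (k - 1) t + cell (horner p) (k
  - 1) t - qc R n * cell (@w R n) (k - 1) t.
  rewrite -mulNr -!cellZ -!cellD; apply: eq_cell => s _.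
  by rewrite /qr /r0 /bubble_res -/p -/(qc R n); ring.
have -> : cell (fun s => 1 - s) k t = cell (@ql R n) k t + cell (horner (p \Po - 'X)) k t
  - qc R n * cell (@w R n) k t.
  rewrite -mulNr -!cellZ -!cellD; apply: eq_cell => s _.
  rewrite /ql /qr /r0 /bubble_res -/p -/(qc R n) w_even // horner_comp hornerN hornerX;
    ring.
ring.
Qed.

(** Subtracting the multiple of the hat with the right value at the middle node leaves a bubble on
    each cell. The hat has value 2 there, hence the halving in [a]. *)
Lemma fspan_two_cells (F1 F2 : {poly R}) (k : int) :
  (size F1 <= N.+1)%N -> (size F2 <= N.+1)%N ->
  F1.[-1] = 0 -> F1.[1] = F2.[-1] -> F2.[1] = 0 ->
  S (fun t => cell (horner F1) (k - 1) t + cell (horner F2) k t).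
Proof.
move=> s1 s2 F10 F12 F20; pose a := F1.[1] / 2.
have b1 : bubble N (F1 - a *: (1 + 'X)).
  split; rewrite ?hornerE ?F10 /a.
  - rewrite (leq_trans (size_polyD _ _)) // geq_max s1 size_polyN.
    rewrite (leq_trans (size_scale_leq _ _)) // addrC -[1]opprK -polyCN size_XsubC; lia.
  - by field.
  - by ring.
have b2 : bubble N (F2 - a *: (1 - 'X)).
  split; rewrite ?hornerE ?F20 -?F12 /a.
  - rewrite (leq_trans (size_polyD _ _)) // geq_max s2 size_polyN.
    rewrite (leq_trans (size_scale_leq _ _)) // -opprB size_polyN size_XsubC; lia.
  - by ring.
  - by field.
have := fspanD (fspanZ a (fspan_hat k)) (fspanD (fspan_cell_bubble (k - 1) b1)
  (fspan_cell_bubble k b2)).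
congr fspan; apply/funext => t; rewrite /hat mulrDr -!cellZ addrACA -!cellD.
by congr (_ + _); apply: eq_cell => s _; rewrite !hornerE /=; ring.
Qed.

(** Both pieces cover the knot 0, so continuity there is built in; dilation by 2 sends this knot to
    an integer, where the gluing condition is needed. *)
Definition piecewise_poly (f : R -> R) (F : {poly R} * {poly R}) : Prop :=
  [/\ (size F.1 <= N.+1)%N, (size F.2 <= N.+1)%N,
      forall s, -1 <= s <= 0 -> f s = F.1.[s] &
      forall s, 0 <= s <= 1 -> f s = F.2.[s]].

Lemma size_polyDZ (p q : {poly R}) a b k : (size p <= k)%N -> (size q <= k)%N ->
  (size (a *: p + b *: q)%R <= k)%N.
Proof.
move=> sp sq; rewrite (leq_trans (size_polyD _ _)) // geq_max.
by rewrite !(leq_trans (size_scale_leq _ _)).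
Qed.

Lemma piecewise_poly_lin f g F G a b : piecewise_poly f F -> piecewise_poly g G ->
  piecewise_poly (fun t => a * f t + b * g t) (a *: F.1 + b *: G.1, a *: F.2 + b *: G.2).
Proof.
move=> [sF1 sF2 f1 f2] [sG1 sG2 g1 g2]; split => /=;
  [exact: size_polyDZ|exact: size_polyDZ| |].
  by move=> s hs; rewrite f1 // g1 // !hornerE.
by move=> s hs; rewrite f2 // g2 // !hornerE.
Qed.

Lemma piecewise_poly_poly (p : {poly R}) : (size p <= N.+1)%N -> piecewise_poly (horner
  p) (p, p).
Proof. by move=> sp; split. Qed.

Lemma piecewise_poly_uM (M : nat) : odd M -> (M <= N)%N -> exists F, piecewise_poly (@uM
  R n M) F.
Proof.
move=> oM MN; have [[sp _ _] _] := is_bubble_proj_bubble_proj (N_gt0 n) (@cont_ubar R M oM).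
set p := bubble_proj N _ in sp.
(* For odd [M], |t|^M is - t^M on the left of 0. *)
exists (1 + 'X^M - p, 1 - 'X^M - p).
have sz a : (size (1 + a *: 'X^M - p)%R <= N.+1)%N.
  rewrite (leq_trans (size_polyD _ _)) // geq_max size_polyN sp andbT.
  rewrite (leq_trans (size_polyD _ _)) // geq_max size_poly1 /=.
  by rewrite (leq_trans (size_scale_leq _ _)) // size_polyXn.
split => /=.
- by have := sz 1; rewrite scale1r.
- by have := sz (-1); rewrite scaleN1r.
- move=> s /andP[_ s0]; rewrite /uM /bubble_res -/p ubarE // /nexp ler0_norm // !hornerE.
  by rewrite exprNn -signr_odd oM /= expr1; ring.
- by move=> s /andP[s0 _]; rewrite /uM /bubble_res -/p ubarE // /nexp ger0_norm // !hornerE.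
Qed.

Lemma piecewise_poly_w : exists F, piecewise_poly (@w R n) F.
Proof.
have [|F1 h1] := @piecewise_poly_uM (2 * n - 1) (odd_M1 n_gt1); first lia.
have [|F2 h2] := @piecewise_poly_uM 1 isT; first lia.
have := piecewise_poly_lin (@alpha R n) 1 h1 h2.
set F := (_, _) => h; exists F; move: h; congr piecewise_poly.
by apply/funext => t; rewrite wE // mul1r.
Qed.

Lemma piecewise_poly_qr : exists F, piecewise_poly (@qr R n) F.
Proof.
have [F h] := piecewise_poly_w.
have := piecewise_poly_lin 1 (qc R n) (piecewise_poly_poly (size_P0 R n)) h.
set G := (_, _) => hG; exists G; move: hG; congr piecewise_poly.
apply/funext => t; rewrite /qr -/(qc R n) mul1r; congr (_ + _).
by rewrite /r0 /bubble_res !hornerE.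
Qed.

Lemma piecewise_poly_ql : exists F, piecewise_poly (@ql R n) F.
Proof.
have [F [s1 s2 h1 h2]] := piecewise_poly_qr.
exists (F.2 \Po - 'X, F.1 \Po - 'X).
have sN (p : {poly R}) : size (p \Po - 'X) = size p.
  by rewrite size_comp_poly2 // size_polyN size_polyX.
split; rewrite /= ?sN // => s /andP[? ?]; rewrite /ql horner_comp hornerN hornerX.
  by apply: h2; apply/andP; split; lra.
by apply: h1; apply/andP; split; lra.
Qed.

Definition left_half (p : {poly R}) : {poly R} := p \Po (2^-1 *: 'X - (2^-1)%:P).
Definition right_half (p : {poly R}) : {poly R} := p \Po (2^-1 *: 'X + (2^-1)%:P).

Lemma horner_left_half p s : (left_half p).[s] = p.[(s - 1) / 2].
Proof. by rewrite /left_half horner_comp !hornerE; congr horner; field. Qed.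

Lemma horner_right_half p s : (right_half p).[s] = p.[(s + 1) / 2].
Proof. by rewrite /right_half horner_comp !hornerE; congr horner; field. Qed.

Lemma size_half (p : {poly R}) c : size (p \Po (2^-1 *: 'X + c%:P)) = size p.
Proof.
rewrite size_comp_poly2 // size_polyDl size_scale ?invr_neq0 ?pnatr_eq0 // size_polyX //.
by rewrite (leq_ltn_trans (size_polyC_leq1 _)).
Qed.

Lemma size_left_half p : size (left_half p) = size p.
Proof. by rewrite /left_half -polyCN size_half. Qed.

Lemma size_right_half p : size (right_half p) = size p.
Proof. exact: size_half. Qed.

Lemma cell_half f F (k : int) t : piecewise_poly f F ->
  cell f k (t / 2) = cell (horner (left_half F.1)) (2 * k) t + cell (horner (right_half
    F.2)) (2 * k + 1) t.
Proof.
move=> [_ _ h1 h2].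
have k1 : (2 * k)%:~R = 2 * k%:~R :> R by rewrite intrM.
have k2 : (2 * k + 1)%:~R = 2 * k%:~R + 1 :> R by rewrite intrD k1.
rewrite /cell k1 k2.
have [hl|hl] := boolP (2 * k%:~R <= t < 2 * k%:~R + 1).
  rewrite ifT; last by apply/andP; lra.
  rewrite ifF ?addr0; last by apply/negbTE/negP => /andP; lra.
  rewrite h1; last by apply/andP; lra.
  by rewrite horner_left_half; congr horner; field.
rewrite add0r; have [hr|hr] := boolP (2 * k%:~R + 1 <= t < 2 * k%:~R + 1 + 1).
  rewrite ifT; last by apply/andP; lra.
  rewrite h2; last by apply/andP; lra.
  by rewrite horner_right_half; congr horner; field.
move: hl hr; rewrite !negb_and -!ltNge -!leNgt => /orP[] ? /orP[] ?;
  by rewrite ifF //; apply/negbTE/negP => /andP; lra.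
Qed.

Lemma piecewise_poly_half f F : piecewise_poly f F ->
  [/\ (left_half F.1).[-1] = f (-1), (left_half F.1).[1] = f 0,
      (right_half F.2).[-1] = f 0 & (right_half F.2).[1] = f 1].
Proof.
move=> [_ _ h1 h2]; rewrite !horner_left_half !horner_right_half.
have -> : (-1 - 1) / 2 = -1 :> R by field.
have -> : (1 + 1) / 2 = 1 :> R by field.
rewrite subrr addNr mul0r.
have i1 : -1 <= (-1 : R) <= 0 by rewrite lexx lerN10.
have i2 : -1 <= (0 : R) <= 0 by rewrite lexx lerN10.
have i3 : 0 <= (0 : R) <= 1 by rewrite lexx ler01.
have i4 : 0 <= (1 : R) <= 1 by rewrite lexx ler01.
by rewrite -(h1 _ i1) -(h1 _ i2) -(h2 _ i3) -(h2 _ i4).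
Qed.

Lemma fspan_cell_half f F (k : int) : piecewise_poly f F -> f (-1) = 0 -> f 1 = 0 ->
  S (fun t => cell f k (t / 2)).
Proof.
move=> hF fN1 f1; have [e1 e2 e3 e4] := piecewise_poly_half hF.
have [s1 s2 _ _] := hF.
have := @fspan_two_cells (left_half F.1) (right_half F.2) (2 * k + 1).
rewrite size_left_half size_right_half e1 e2 e3 e4 fN1 f1 addrK.
move=> /(_ s1 s2 erefl erefl erefl); congr fspan.
by apply/funext => t; rewrite (cell_half _ _ hF).
Qed.

Lemma fspan_translates_half a : S (fun t => T a (t / 2)).
Proof.
have E : (fun t => T a (t / 2)) =
    (fun t => cell (@lpart R n a.1) (a.2 - 1) (t / 2) + cell (@rpart R n a.1) a.2 (t / 2)).
  by apply/funext => t; rewrite translatesE.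
rewrite E {E}; case: a => [[[|[|i]] Hi] k] /=.
- have [F hF] := piecewise_poly_qr; have [G hG] := piecewise_poly_ql.
  have [e1 e2 e3 e4] := piecewise_poly_half hF.
  have [d1 d2 d3 d4] := piecewise_poly_half hG.
  have [s1 s2 _ _] := hF; have [r1 r2 _ _] := hG.
  have sX (p : {poly R}) a : (size p <= N.+1)%N -> (size (p - (1 + a *: 'X))%R <= N.+1)%N.
    move=> sp; rewrite (leq_trans (size_polyD _ _)) // geq_max sp size_polyN.
    rewrite (leq_trans (size_polyD _ _)) // geq_max size_poly1 /=.
    by rewrite (leq_trans (size_scale_leq _ _)) // size_polyX; lia.
  (* The dilated generator occupies four cells with inner nodes 2 k - 1, 2 k, 2 k + 1. Its value at
     2 k is qr(1) = 2, that of [hat (2 * k)]; without this hat it splits into [A] around 2 k - 1 and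
     [B] around 2 k + 1. *)
  have A : S (fun t => cell (horner (left_half F.1)) (2 * k - 1 - 1) t +
      cell (horner (right_half F.2 - (1 + 1 *: 'X))) (2 * k - 1) t).
    apply: fspan_two_cells; [by rewrite size_left_half|by apply: sX;
      rewrite size_right_half| | |].
    - by rewrite e1 qr_N1.
    - by rewrite !hornerE e2 e3; ring.
    - by rewrite !hornerE e4 qr_1 //; ring.
  have B : S (fun t => cell (horner (left_half G.1 - (1 + (-1) *: 'X))) (2 * k + 1 - 1) t +
      cell (horner (right_half G.2)) (2 * k + 1) t).
    apply: fspan_two_cells; [by apply: sX;
      rewrite size_left_half|by rewrite size_right_half| | |].
    - by rewrite !hornerE d1 /ql opprK qr_1 //; ring.
    - by rewrite !hornerE d2 d3; ring.
    - by rewrite d4 /ql qr_N1.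
  have := fspanD (fspan_hat (2 * k)) (fspanD A B); congr fspan; apply/funext => t.
  rewrite (cell_half _ _ hF) (cell_half _ _ hG) /hat addrK.
  have -> : (2 * (k - 1) = 2 * k - 1 - 1)%R by ring.
  have -> : (2 * k - 1 - 1 + 1 = 2 * k - 1)%R by ring.
  have -> : cell (horner (right_half F.2)) (2 * k - 1) t = cell (fun s => 1 + s) (2 * k -
    1) t +
      cell (horner (right_half F.2 - (1 + 1 *: 'X))) (2 * k - 1) t.
    by rewrite -cellD; apply: eq_cell => s _; rewrite !hornerE /=; ring.
  have -> : cell (horner (left_half G.1)) (2 * k) t = cell (fun s => 1 - s) (2 * k) t +
      cell (horner (left_half G.1 - (1 + (-1) *: 'X))) (2 * k) t.
    by rewrite -cellD; apply: eq_cell => s _; rewrite !hornerE /=; ring.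
  ring.
- have [F hF] := piecewise_poly_w.
  have := fspan_cell_half k hF (w_N1 R n_gt1) (w_1 R n_gt1); congr fspan; apply/funext => t.
  by rewrite [X in X + _](_ : _ = 0) ?add0r // /cell; case: ifP.
- have [sp p1 pN1] : bubble N (phi0_poly R i.+2) := @rpart_bubble R n n_gt1 (Ordinal Hi)
    isT.
  have := fspan_cell_half k (piecewise_poly_poly sp) pN1 p1; congr fspan; apply/funext => t.
  by rewrite [X in X + _](_ : _ = 0) ?add0r // /cell; case: ifP.
Qed.

Lemma fspan_half h : S h -> S (fun t => h (t / 2)).
Proof.
move=> [s [c ->]]; apply: (fspan_sum _ (h := fun a t => c a * T a (t / 2))) => a.
by apply: fspanZ; exact: fspan_translates_half.
Qed.

End Refinement.

(** * Dilation in L2 *)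

Section Scaling.
Variable R : realType.
Notation mu := (@lebesgue_measure R).

Lemma integral_half_sqr (f : R -> R) : measurable_fun setT f ->
  (\int[mu]_x (f (x / 2) ^+ 2)%:E = 2%:E * \int[mu]_x (f x ^+ 2)%:E)%E.
Proof.
move=> mf; have two : (0 : R) < 2 by lra.
have mh : measurable_fun setT (fun x : R => f (x / 2)).
  apply: measurableT_comp => //; apply: continuous_measurable_fun.
  by apply: contM; [move=> x; exact: cvg_id|exact: cont_cst].
rewrite (ge0_integral_affine 0 two) /=; last 2 first.
- by apply/measurable_EFinP; exact: measurable_funX.
- by move=> x; rewrite lee_fin sqr_ge0.
congr (_ * _)%E; apply: eq_integral => x _; congr ((f _ ^+ 2)%:E); by field.
Qed.

Lemma L2norm_half_sqr (f : R -> R) : measurable_fun setT f ->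
  L2norm (fun x => f (x / 2)) ^+ 2 = 2 * L2norm f ^+ 2.
Proof.
move=> mf; rewrite !L2norm_sqr /Rintegral integral_half_sqr //.
have : (0 <= \int[mu]_x (f x ^+ 2)%:E)%E.
  by apply: integral_ge0 => x _; rewrite lee_fin sqr_ge0.
case: (\int[mu]_x _)%E => [r| |] //= _.
by rewrite gt0_muley ?lte_fin //= mulr0.
Qed.

Lemma L2_half (f : R -> R) : L2 f -> L2 (fun x => f (x / 2)).
Proof.
move=> /L2P[mf fin]; apply/L2P; split.
  apply: measurableT_comp => //; apply: continuous_measurable_fun.
  by apply: contM; [move=> x; exact: cvg_id|exact: cont_cst].
rewrite integral_half_sqr // lte_mul_pinfty //.
Qed.

End Scaling.

(** * Nesting, compact supports and the two basis properties *)

Section Main.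
Variables (R : realType) (n : nat).
Hypothesis n_gt1 : (1 < n)%N.
Notation N := (4 * n + 1)%N.
Notation T := (translates (@tphi R n)).

Lemma measurable_lincomb s c : measurable_fun setT (lincomb T s c).
Proof.
rewrite /lincomb; elim: s => [|a s IH].
  by under eq_fun do rewrite big_nil; exact: measurable_cst.
under eq_fun do rewrite big_cons.
apply: measurable_funD => //; apply: measurable_funM => //; exact: measurable_translates.
Qed.

Lemma closed_span_half f : closed_span T f -> closed_span T (fun t => f (t / 2)).
Proof.
move=> [fL2 fapp]; split; first exact: L2_half.
(* Dilation multiplies the norm by the square root of 2, which is less than 2, so halving [eps]
   suffices; the comparison is made on squares. *)
move=> eps eps0; have [|s [c sc]] := fapp (eps / 2); first lra.
have [s' [c' E]] := fspan_half n_gt1 (ex_intro _ s (ex_intro _ c erefl)).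
exists s', c'; rewrite -E.
have mf : measurable_fun setT (f \- lincomb T s c).
  by apply: measurable_funB; [case/L2P: fL2|exact: measurable_lincomb].
have y2 := L2norm_half_sqr mf; have x0 := L2norm_ge0 (f \- lincomb T s c).
have -> : (fun t => f (t / 2)) \- (fun t => lincomb T s c (t / 2)) =
  (fun t => (f \- lincomb T s c) (t / 2)) by [].
rewrite ltNge; apply/negP => ey.
have : eps ^+ 2 <= 2 * L2norm (f \- lincomb T s c) ^+ 2 by rewrite -y2 lerXn2r ?nnegrE
  ?L2norm_ge0 // ltW.
have : L2norm (f \- lincomb T s c) ^+ 2 < (eps / 2) ^+ 2 by rewrite ltrXn2r ?nnegrE //; lra.
have : 0 < eps ^+ 2 by rewrite exprn_gt0.
rewrite exprMn exprVn; lra.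
Qed.

(** All inclusions reduce to the stability of V_0 under the dilation t / 2, since f(2^p t) is
    g(2^(p+1) t) with g(t) = f(t / 2). *)
Lemma mra_space_subset (p : int) : mra_space (@tphi R n) p `<=` mra_space (@tphi R n) (p
  + 1).
Proof.
move=> _ [f fV <-]; exists (fun t => f (t / 2)); first exact: closed_span_half.
apply/funext => t; congr f; rewrite expfzDr ?pnatr_eq0 // expr1z; by field.
Qed.

Lemma compactly_supported_tphi i : compactly_supported (@tphi R n i).
Proof.
apply: (subclosed_compact _ (@segment_compact R (-1) 1)); first exact: closed_closure.
have cl : closed (`[-1, 1]%classic : set R) by exact: itv_closed.
rewrite ((closure_id _).1 cl); apply: closure_subset => t /= /negP; rewrite in_itv /= => tn.
have [//|t1] := boolP (-1 <= t <= 1).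
exfalso; apply: tn; apply/eqP; rewrite tphiE /cell rmorphN /= addNr add0r.
rewrite ifF; last by apply: contraNF t1 => /andP; lra.
by rewrite ifF ?addr0 //; apply: contraNF t1 => /andP; lra.
Qed.

Lemma L2_tphi i : L2 (@tphi R n i).
Proof.
have := L2_translates R n_gt1 (i, 0); congr L2.
by apply/funext => t; rewrite /translates subr0.
Qed.

Lemma riesz_basis_translates : riesz_basis T (mra_space0 (@tphi R n)).
Proof.
split => //; first by move=> a; exact: L2_translates.
have g0 := @gram_norm_gt0 R n n_gt1.
(* The Gram matrix is diagonal and its entries depend only on the generator. The sum of these
   finitely many positive numbers bounds each from above, and the inverse of the sum of their
   inverses bounds each from below. *)
pose B := \sum_(i < N.+1) gram_norm R i; pose A := (\sum_(i < N.+1) (gram_norm R i)^-1)^-1.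
have leS (F : 'I_N.+1 -> R) i : (forall j, 0 < F j) -> F i <= \sum_j F j.
  move=> F0; rewrite (bigD1 i) //= lerDl; apply: sumr_ge0 => j _; exact: ltW.
have posS (F : 'I_N.+1 -> R) : (forall j, 0 < F j) -> 0 < \sum_j F j.
  by move=> F0; apply: lt_le_trans (F0 ord0) (leS F ord0 F0).
have gV (j : 'I_N.+1) : 0 < (gram_norm R j)^-1 by rewrite invr_gt0; exact: g0.
exists A, B; split; [by rewrite invr_gt0 posS|exact: posS|].
move=> s c us; rewrite (L2norm_lincomb_sqr (integrable_translates_mul R n_gt1)
  (gram_translates R n_gt1)) //.
rewrite !mulr_sumr; apply/andP; split; apply: ler_sum => a _.
  rewrite mulrC ler_wpM2l ?sqr_ge0 // /A -[leRHS]invrK lef_pV2 ?posrE ?posS //.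
  exact: (leS (fun j => (gram_norm R j)^-1)).
by rewrite [leRHS]mulrC ler_wpM2l ?sqr_ge0 //; exact: leS.
Qed.

Lemma orthogonal_basis_translates : orthogonal_basis T (mra_space0 (@tphi R n)).
Proof.
split => //.
- by move=> a; exact: L2_translates.
- move=> a; rewrite -sqrf_eq0 L2norm_sqr.
  have := gram_translates R n_gt1 a a; rewrite eqxx /L2dot.
  under eq_Rintegral do rewrite -expr2.
  by move=> ->; rewrite gt_eqF // gram_norm_gt0.
- by move=> a b /negbTE ab; rewrite gram_translates // ab.
Qed.

End Main.

Theorem theorem16 (R : realType) (n : nat) (hn : (1 < n)%N) :
  generates_orthogonal_mra (@tphi R n).
Proof.
split; last exact: orthogonal_basis_translates.
split; [exact: L2_tphi|exact: compactly_supported_tphi|exact: mra_space_subset|].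
exact: riesz_basis_translates.
Qed.
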